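(* Let $n\ge2$ and let $1+\frac4n<p<\frac{n+2}{n-2}$ (i.e. $3<p<\infty$ if $n=2$). Then there is no energy minimizer $u\in H^1(\mathbb R^n)$ within its mass class, at any positive mass; that is, for every $\beta>0$ there is no $u\in H^1(\mathbb R^n)$ with $\|u\|_{L^2}^2=\beta$ and $$E(u)=\inf\{E(w):w\in H^1(\mathbb R^n),\ \|w\|_{L^2}^2=\beta\}.$$
   Context: $E(w)=\frac12\|\nabla w\|_{L^2}^2-\frac1{p+1}\int_{\mathbb R^n}|w|^{p+1}\,dx$. The infimum is taken in $[-\infty,\infty)$. *)

(* Defs.v *)
From HB Require Import structures.
From mathcomp Require Import all_boot all_order all_algebra.
From mathcomp Require Import all_classical all_reals all_analysis.
Set Implicit Arguments.
Unset Strict Implicit.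
Unset Printing Implicit Defensive.
Import Order.TTheory GRing.Theory Num.Theory.
Import numFieldNormedType.Exports.
Local Open Scope classical_set_scope.
Local Open Scope ring_scope.

Section measurable_rV.
Context {R : realType}.
Variable n : nat.

Let coord : 'I_n -> 'rV[R]_n -> measurableTypeR R := fun i v => v ord0 i.

Let rV_set0 : g_sigma_preimage coord set0.
Proof. exact: sigma_algebra0. Qed.

Let rV_setC A : g_sigma_preimage coord A -> g_sigma_preimage coord (~` A).
Proof. exact: sigma_algebraC. Qed.

Let rV_bigcup (F : (set 'rV[R]_n)^nat) :
  (forall i, g_sigma_preimage coord (F i)) ->
  g_sigma_preimage coord (\bigcup_i F i).
Proof. exact: sigma_algebra_bigcup. Qed.

(* The sigma-algebra generated by the coordinates, that is, the Borel
   sigma-algebra of R^n. *)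
HB.instance Definition _ :=
  @isMeasurable.Build (measure_tuple_display default_measure_display)
    'rV[R]_n (g_sigma_preimage coord) rV_set0 rV_setC rV_bigcup.

End measurable_rV.

Section lebesgue_rV.
Context {R : realType}.

Lemma measurable_coord n (i : 'I_n) :
  measurable_fun setT (fun v : 'rV[R]_n => v ord0 i : measurableTypeR R).
Proof.
move=> _ Y mY; rewrite setTI; apply: sub_sigma_algebra => /=.
rewrite -bigcup_seq/=; exists i => /=; first by rewrite mem_index_enum.
by exists Y => //; rewrite setTI.
Qed.

Lemma measurable_fun_rV d (T : measurableType d) n (f : T -> 'rV[R]_n) :
  (forall i, measurable_fun setT (fun x => f x ord0 i : measurableTypeR R)) ->
  measurable_fun setT f.
Proof.
move=> mf _ A mA; rewrite setTI.
have : (<<s \big[setU/set0]_(i < n) preimage_set_system setT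
    (fun v : 'rV[R]_n => v ord0 i : measurableTypeR R) measurable >>)
    `<=` [set A | measurable (f @^-1` A)].
  apply: smallest_sub.
    split => [|B mB|F mF] /=.
    - by rewrite preimage_set0.
    - by rewrite setTD -preimage_setC; exact: measurableC.
    - by rewrite preimage_bigcup; apply: bigcupT_measurable.
  rewrite -bigcup_seq => B [i _ [C mC <-]] /=.
  by rewrite setTI -[X in measurable X]setTI; exact: mf.
exact.
Qed.

Definition cons_rV n (z : measurableTypeR R * 'rV[R]_n) : 'rV[R]_n.+1 :=
  row_mx (z.1)%:M z.2.

Lemma cons_rV0 n z : @cons_rV n z ord0 ord0 = z.1.
Proof.
transitivity (row_mx (z.1)%:M z.2 ord0 (lshift n (ord0 : 'I_1))).
  by congr (fun_of_matrix _ _ _); exact/val_inj.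
by rewrite row_mxEl mxE mulr1n.
Qed.

Lemma cons_rVS n z (i : 'I_n) : @cons_rV n z ord0 (lift ord0 i) = z.2 ord0 i.
Proof.
transitivity (row_mx (z.1)%:M z.2 ord0 (rshift 1 i)); last exact: row_mxEr.
by congr (fun_of_matrix _ _ _); exact/val_inj.
Qed.

Lemma measurable_cons_rV n : measurable_fun setT (@cons_rV n).
Proof.
apply: measurable_fun_rV => i; case: (unliftP ord0 i) => [j ->|->].
  under eq_fun do rewrite cons_rVS.
  by apply: (measurableT_comp (measurable_coord j)); exact: measurable_snd.
under eq_fun do rewrite cons_rV0.
exact: measurable_fst.
Qed.

HB.instance Definition _ n :=
  @isMeasurableFun.Build _ _ _ _ (@cons_rV n) (@measurable_cons_rV n).

Section lebesgue_rV_succ.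
Variable n : nat.
Variable mu : {sigma_finite_measure set 'rV[R]_n -> \bar R}.

Definition lebesgue_rV_succ : set 'rV[R]_n.+1 -> \bar R :=
  pushforward (@lebesgue_measure R \x mu)%E (@cons_rV n).

Let lebesgue_rV_succ0 : lebesgue_rV_succ set0 = 0%E.
Proof. exact: measure0. Qed.

Let lebesgue_rV_succ_ge0 A : (0 <= lebesgue_rV_succ A)%E.
Proof. exact: measure_ge0. Qed.

Let lebesgue_rV_succ_sigma_additive : semi_sigma_additive lebesgue_rV_succ.
Proof. exact: measure_semi_sigma_additive. Qed.

HB.instance Definition _ := isMeasure.Build _ _ _ lebesgue_rV_succ
  lebesgue_rV_succ0 lebesgue_rV_succ_ge0 lebesgue_rV_succ_sigma_additive.

Let lebesgue_rV_succ_sigma_finite : sigma_finite setT lebesgue_rV_succ.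
Proof.
have /sigma_finiteP[F [FT ndF Foo]] := sigma_finiteT (@lebesgue_measure R).
have /sigma_finiteP[G [GT ndG Goo]] := sigma_finiteT mu.
pose uncons (v : 'rV[R]_n.+1) : measurableTypeR R * 'rV[R]_n :=
  (v ord0 ord0, \row_j v ord0 (lift ord0 j)).
exists (fun k => uncons @^-1` (F k `*` G k)).
  rewrite -preimage_bigcup; apply/esym/seteqP; split => // v _.
  have [k _ Fk] : (\bigcup_i F i) (uncons v).1 by rewrite -FT.
  have [l _ Gl] : (\bigcup_i G i) (uncons v).2 by rewrite -GT.
  exists (maxn k l) => //; split.
  - by move: Fk; exact/subsetPset/ndF/leq_maxl.
  - by move: Gl; exact/subsetPset/ndG/leq_maxr.
have muncons : measurable_fun setT uncons.
  apply/measurable_fun_pairP; split; first exact: measurable_coord.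
  apply: measurable_fun_rV => i; rewrite /uncons /=.
  by under eq_fun do rewrite mxE; exact: measurable_coord.
move=> k; have [mF Fk] := Foo k; have [mG Gk] := Goo k; split.
  by rewrite -[X in measurable X]setTI; apply: muncons => //; exact: measurableX.
rewrite /lebesgue_rV_succ /pushforward -comp_preimage.
rewrite (_ : uncons \o _ = id).
  by rewrite product_measure1E// lte_mul_pinfty// ge0_fin_numE.
apply/funext => -[x v]; rewrite /uncons /= cons_rV0; congr pair; apply/rowP => j.
by rewrite mxE cons_rVS.
Qed.

HB.instance Definition _ := Measure_isSigmaFinite.Build _ _ _
  lebesgue_rV_succ lebesgue_rV_succ_sigma_finite.

End lebesgue_rV_succ.

(* Lebesgue measure on R^n, as the n-fold product of the one on R. *)
Fixpoint lebesgue_rV n : {sigma_finite_measure set 'rV[R]_n -> \bar R} :=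
  match n with
  | 0 => \d_(0 : 'rV[R]_0)
  | n'.+1 => lebesgue_rV_succ (lebesgue_rV n')
  end.

Lemma lebesgue_rV_box n (A : 'I_n -> set (measurableTypeR R)) :
  (forall i, measurable (A i)) ->
  lebesgue_rV n [set v | forall i, A i (v ord0 i)] =
  (\prod_(i < n) lebesgue_measure (A i))%E.
Proof.
elim: n A => [|n IHn] A mA.
  by rewrite big_ord0 /= diracE mem_set// => -[].
rewrite big_ord_recl -IHn => [|i]; last exact: mA.
pose B := [set v : 'rV[R]_n | forall i, A (lift ord0 i) (v ord0 i)].
transitivity ((lebesgue_measure \x lebesgue_rV n)%E (A ord0 `*` B)).
  congr (product_measure1 _ _ _); apply/seteqP; split => -[x v] /=.
    move=> h; split=> [|i]; first by have := h ord0; rewrite cons_rV0.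
    by have := h (lift ord0 i); rewrite cons_rVS.
  move=> [A0 h] i.
  by case: (unliftP ord0 i) => [j ->|->]; rewrite ?cons_rVS ?cons_rV0//; exact: h.
apply: product_measure1E; first exact: mA.
rewrite (_ : B = \bigcap_(i in [set: 'I_n])
    ((fun v : 'rV[R]_n => v ord0 i) @^-1` A (lift ord0 i))).
  apply: fin_bigcap_measurable => // i _.
  by rewrite -[X in measurable X]setTI; apply: measurable_coord => //; exact: mA.
by apply/seteqP; split => v /= h i; [move=> _|]; exact: h.
Qed.

End lebesgue_rV.

Section sobolev.
Context {R : realType} {n : nat}.
Implicit Types (phi u w : 'rV[R]_n -> R) (v x : 'rV[R]_n) (i : 'I_n).

Local Notation mu := (lebesgue_rV n).

(* The norm `|v| of the library on 'rV[R]_n is the sup norm. *)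
Definition eucl_norm v : R := Num.sqrt (\sum_i v ord0 i ^+ 2).

Definition partial i phi x : R := 'D_(delta_mx ord0 i) phi x.

Fixpoint Ck (k : nat) phi : Prop :=
  continuous phi /\
  if k is k'.+1 then
    forall i, (forall x, derivable phi x (delta_mx ord0 i)) /\
              Ck k' (partial i phi)
  else True.

(* C_c^oo(R^n) *)
Definition test_function phi : Prop :=
  (forall k, Ck k phi) /\ compact (closure [set x | phi x != 0]).

Definition is_weak_grad u (g : 'rV[R]_n -> 'rV[R]_n) : Prop :=
  forall i phi, test_function phi ->
    (\int[mu]_x (u x * partial i phi x)%:E =
     - \int[mu]_x (g x ord0 i * phi x)%:E)%E.

Definition L2_weak_grad u (g : 'rV[R]_n -> 'rV[R]_n) : Prop :=
  (forall i, (fun x => g x ord0 i) \in Lfun mu 2%:E) /\ is_weak_grad u g.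

(* Real-valued H^1(R^n); every class has a Borel representative. *)
Definition sobolev_H1 u : Prop :=
  u \in Lfun mu 2%:E /\ exists g, L2_weak_grad u g.

(* The weak gradient of u in H^1, which is unique up to a null set. *)
Definition weak_grad u : 'rV[R]_n -> 'rV[R]_n := get (L2_weak_grad u).

Definition mass u : \bar R := ('N[mu]_2%:E[EFin \o u] ^+ 2)%E.

(* The potential term is an integral in [0, +oo]; that it is finite on H^1 for
   subcritical p (Sobolev embedding) is not built into the definition. *)
Definition energy (p : R) w : \bar R :=
  (2^-1%:E * 'N[mu]_2%:E[EFin \o (eucl_norm \o weak_grad w)] ^+ 2
   - (p + 1)^-1%:E * \int[mu]_x (`|w x| `^ (p + 1))%:E)%E.

End sobolev.

(* Main.v *)
(* If [u] minimizes [E] at mass [beta], compare it with [l ^ (n / 2) u (l x)], which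
   has the same mass and energy [l ^ 2 a - l ^ s b], where [s = n (p - 1) / 2 > 2],
   [a] is half the squared norm of the gradient, and [b] is the potential energy.
   Since [b > 0], large [l] beat [l = 1], provided [b] is finite: otherwise the
   energy of [u] is [-oo] and [u] would be a minimizer. So the point is the embedding
   of [H^1] in [L^(p + 1)] for subcritical [p].

   The embedding is proved on level sets. Testing the weak gradient against products
   of one-dimensional bumps shows that the increment of [u] along a coordinate
   direction is a.e. the integral of the partial derivative, whence
   [|{t < |u (x + y) - u x|}| <= C l ^ 2 / t ^ 2] for [y] in a cube of edge [l].
   For [l ^ n = 2 |{t < |u|}|], a translation by a typical [y] in the cube moves half
   of [{2 t < |u|}] off [{t < |u|}], so
   [|{2 t < |u|}| <= K t ^ -2 |{t < |u|}| ^ (2 / n)].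
   Iterating this gives decay [t ^ -al] of the level sets for some [al > p + 1]. *)
Require Import Defs.
From HB Require Import structures.
From mathcomp Require Import all_boot all_order all_algebra.
From mathcomp Require Import all_classical all_reals all_analysis.
From mathcomp Require Import measurable_realfun.
From mathcomp Require Import ring lra.
Set Implicit Arguments.
Unset Strict Implicit.
Unset Printing Implicit Defensive.
Import Order.TTheory GRing.Theory Num.Theory.
Import numFieldNormedType.Exports.
Local Open Scope classical_set_scope.
Local Open Scope ring_scope.

(** * Lebesgue measure under dilations and translations *)

(** The hypothesis [(1 - 2 / n%:R) * q < 2] of the embedding says that [q] lies below the critical
    exponent 2n/(n-2), and it is automatic for n = 2. That exponent is the fixed point of al -> 2 +
    2 al / n, so an iteration started at 0 passes every smaller [q]: strict subcriticality pays for
    the loss in the weak-type bounds. Since only finiteness of the potential energy of one function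
    is at stake, the constants may depend on [u].

    The weak gradient is accessible only through integrals against test functions. Products of bumps
    suffice as tests because they converge to indicators of open boxes, and boxes determine Borel
    measures. Averaging such a product along a coordinate segment gives another such product, whose
    partial derivative is a difference of translates; this turns the definition of the weak gradient
    into a formula for increments.

    [weak_grad] is an arbitrary choice, so the energy of a dilated function is known only once weak
    gradients are shown to be a.e. unique, which the same tests give. The exponent s is (n / 2)(p +
    1) - n, where -n comes from the change of variables. *)

Section boxes.
Context {R : realType} {n : nat}.
Implicit Types (a b t : 'rV[R]_n) (c : R).

(** Some edges may be empty, which keeps the family closed under intersection; this is why volumes
    below contain [Num.max 0]. *)
Definition obox a b : set 'rV[R]_n :=
  [set v | forall i, `]a ord0 i, b ord0 i[%classic (v ord0 i)].

Definition oboxes : set (set 'rV[R]_n) := [set obox ab.1 ab.2 | ab in setT].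

Lemma measurable_obox a b : measurable (obox a b).
Proof.
rewrite (_ : obox a b = \bigcap_(i in [set: 'I_n])
  ((fun v : 'rV[R]_n => v ord0 i) @^-1` `]a ord0 i, b ord0 i[%classic)).
  apply: fin_bigcap_measurable => // i _.
  by rewrite -[X in measurable X]setTI; exact: measurable_coord.
by apply/seteqP; split => v /= h i; [move=> _|]; exact: h.
Qed.

Lemma lebesgue_obox a b : lebesgue_rV n (obox a b) =
  (\prod_(i < n) lebesgue_measure `]a ord0 i, b ord0 i[%classic)%E.
Proof. by apply: (lebesgue_rV_box (A := fun i => `]a ord0 i, b ord0 i[%classic)). Qed.

Lemma obox_lty a b : (lebesgue_rV n (obox a b) < +oo)%E.
Proof.
have fin i : lebesgue_measure `]a ord0 i, b ord0 i[%classic \is a fin_num.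
  by rewrite lebesgue_measure_itv/=; case: ifPn => // _; rewrite -EFinB.
suff : (\prod_(i < n) lebesgue_measure `]a ord0 i, b ord0 i[%classic)%E \is a fin_num.
  by move=> h; rewrite lebesgue_obox ltey_eq h.
by elim/big_ind: _ => // x y; exact: fin_numM.
Qed.

Lemma oboxI a b a' b' : obox a b `&` obox a' b' =
  obox (\row_i Num.max (a ord0 i) (a' ord0 i)) (\row_i Num.min (b ord0 i) (b' ord0 i)).
Proof.
apply/seteqP; split => v /=.
  move=> [h h'] i; move: (h i) (h' i); rewrite /= !in_itv/= !mxE gt_max lt_min.
  by move=> /andP[-> ->] /andP[-> ->].
move=> h; split=> i; move: (h i); rewrite /= !in_itv/= !mxE gt_max lt_min.
  by move=> /andP[/andP[-> _] /andP[-> _]].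
by move=> /andP[/andP[_ ->] /andP[_ ->]].
Qed.

Lemma oboxes_setI : setI_closed oboxes.
Proof.
move=> _ _ [[a b] _ <-] [[a' b'] _ <-]; rewrite oboxI.
by exists (\row_i Num.max (a ord0 i) (a' ord0 i), \row_i Num.min (b ord0 i) (b' ord0 i)).
Qed.

Definition cube k : set 'rV[R]_n := obox (const_mx (- k%:R)) (const_mx k%:R).

Lemma bigcup_cube : \bigcup_k cube k = setT.
Proof.
apply/seteqP; split => // v _.
pose M := \sum_i `|v ord0 i|.
exists (Num.truncn M).+1 => //= i; rewrite /= in_itv/= !mxE -ltr_norml.
apply: le_lt_trans (truncnS_gt M).
by rewrite /M (bigD1 i)//= lerDl sumr_ge0.
Qed.

(** The sigma-algebra is defined by coordinates. A half-space [x < v ord0 i] is the increasing union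
    of boxes whose other edges are []-k, k[], so boxes already generate it. *)
Lemma measurable_rV_oboxes : measurable = <<s oboxes >> :> set (set 'rV[R]_n).
Proof.
apply/seteqP; split; last first.
  apply: smallest_sub; first exact: sigma_algebra_measurable.
  by move=> _ [[a b] _ <-]; exact: measurable_obox.
rewrite /measurable/= /g_sigma_preimage.
apply: smallest_sub; first exact: smallest_sigma_algebra.
rewrite -bigcup_seq => B [i _ [C mC <-]] /=; rewrite setTI.
pose S := [set A : set (measurableTypeR R) |
  <<s oboxes >> ((fun v : 'rV[R]_n => v ord0 i) @^-1` A)].
have SS : sigma_algebra setT S.
  split.
  - by rewrite /S/= preimage_set0; exact: sigma_algebra0.
  - by move=> A SA; rewrite /S/= setTD preimage_setC; exact: sigma_algebraC.
  - by move=> A SA; rewrite /S/= preimage_bigcup; exact: sigma_algebra_bigcup.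
suff : measurable `<=` S by exact.
rewrite (RGenOInfty.measurableE R); apply: smallest_sub => //.
move=> _ [x ->]; rewrite /S/=.
rewrite (_ : _ @^-1` _ = \bigcup_k obox (\row_j if j == i then x else - k%:R) (const_mx k%:R)).
  apply: sigma_algebra_bigcup => k; apply: sub_sigma_algebra.
  by exists ((\row_j if j == i then x else - k%:R), (const_mx k%:R)).
apply/seteqP; split => v /=.
  rewrite in_itv/= andbT => xv.
  have [k _ kv] : (\bigcup_k cube k) v by rewrite bigcup_cube.
  exists k => //= j; move: (kv j); rewrite /= !in_itv/= !mxE.
  by case: eqP => // -> /andP[_ ->]; rewrite xv.
by move=> [k _ /(_ i)]; rewrite /= !in_itv/= !mxE eqxx => /andP[-> _].
Qed.

(** Serves twice: to compare a dilated Lebesgue measure with a multiple of Lebesgue measure, and to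
    compare the measures with densities [H^+] and [H^-] in the fundamental lemma. *)
Lemma measure_rV_unique (m1 m2 : {measure set 'rV[R]_n -> \bar R}) :
  (forall a b, m1 (obox a b) = m2 (obox a b)) ->
  (forall k, m1 (cube k) < +oo)%E ->
  forall A, measurable A -> m1 A = m2 A.
Proof.
move=> m12 m1oo A mA; apply: (measure_unique oboxes cube) => //.
- exact: measurable_rV_oboxes.
- exact: oboxes_setI.
- by move=> k; exists (const_mx (- k%:R), const_mx k%:R).
- exact: bigcup_cube.
- by move=> _ [[a b] _ <-]; exact: m12.
Qed.

Definition affine c t (x : 'rV[R]_n) : 'rV[R]_n := c *: x + t.

Lemma measurable_affine c t : measurable_fun setT (affine c t).
Proof.
apply: measurable_fun_rV => i; under eq_fun do rewrite !mxE.
apply: (measurableT_comp (f := fun y : measurableTypeR R => c * y + t ord0 i)).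
  by apply: measurable_funD => //; exact: measurable_funM.
exact: measurable_coord.
Qed.

HB.instance Definition _ c t :=
  @isMeasurableFun.Build _ _ _ _ (affine c t) (@measurable_affine c t).

Lemma preimage_affine_obox c t a b : 0 < c ->
  affine c t @^-1` obox a b = obox (c^-1 *: (a - t)) (c^-1 *: (b - t)).
Proof.
move=> c0.
have E x i : (`]a ord0 i, b ord0 i[%classic ((affine c t x) ord0 i)) =
    (`](c^-1 *: (a - t)) ord0 i, (c^-1 *: (b - t)) ord0 i[%classic (x ord0 i)).
  by rewrite /= !in_itv/= !mxE ltr_pdivrMl// ltr_pdivlMl// ltrBlDr ltrBrDr.
by apply/seteqP; split => v /= h i; move: (h i); rewrite E.
Qed.

Lemma lebesgue_measure_oo (x y : R) :
  lebesgue_measure `]x, y[%classic = (Num.max 0 (y - x))%:E.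
Proof.
rewrite lebesgue_measure_itv/= lte_fin; case: ltP => xy.
  by rewrite -EFinB max_r// subr_ge0 ltW.
by rewrite max_l// subr_le0.
Qed.

Lemma lebesgue_oboxE a b :
  lebesgue_rV n (obox a b) = (\prod_i Num.max 0 (b ord0 i - a ord0 i))%:E.
Proof.
rewrite lebesgue_obox -prodEFin; apply: eq_bigr => i _.
exact: lebesgue_measure_oo.
Qed.

(** On a box each of the [n] edges is divided by [c]; uniqueness of measures extends this to all
    Borel sets. *)
Lemma lebesgue_affine c t A : 0 < c -> measurable A ->
  lebesgue_rV n (affine c t @^-1` A) = ((c ^- n)%:E * lebesgue_rV n A)%E.
Proof.
move=> c0 mA.
have cn0 : 0 <= c ^- n by rewrite invr_ge0 exprn_ge0// ltW.
pose m2 : {measure set 'rV[R]_n -> \bar R} := mscale (NngNum cn0) (lebesgue_rV n).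
pose m1 : {measure set 'rV[R]_n -> \bar R} := 
  measure_function_pushforward__canonical__measure_function_Measure
    (lebesgue_rV n) (measurable_affine c t).
have mE (a b : 'rV[R]_n) : m1 (obox a b) = m2 (obox a b).
  have -> : m2 (obox a b) = (c ^- n * \prod_i Num.max 0 (b ord0 i - a ord0 i))%:E.
    by rewrite EFinM; congr (_ * _)%E; exact: lebesgue_oboxE.
  rewrite /m1 /= /pushforward preimage_affine_obox// lebesgue_oboxE; congr EFin.
  have -> : c ^- n = \prod_(i < n) c^-1 by rewrite prodr_const card_ord exprVn.
  rewrite -big_split/=; apply: eq_bigr => i _; rewrite !mxE -mulrBr.
  by rewrite maxr_pMr ?invr_ge0 ?ltW// mulr0; congr (Num.max _ (_ * _)); ring.
apply: (measure_rV_unique (m1 := m1) (m2 := m2)) => // k.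
by rewrite /m1 /= /pushforward preimage_affine_obox// obox_lty.
Qed.

Lemma ge0_integral_affine c t (f : 'rV[R]_n -> \bar R) : 0 < c ->
  measurable_fun setT f -> (forall x, 0 <= f x)%E ->
  (\int[lebesgue_rV n]_x f (c *: x + t)%R = (c ^- n)%:E * \int[lebesgue_rV n]_x f x)%E.
Proof.
move=> c0 mf f0.
have cn0 : 0 <= c ^- n by rewrite invr_ge0 exprn_ge0// ltW.
transitivity (\int[pushforward (lebesgue_rV n) (affine c t)]_x f x)%E.
  by rewrite ge0_integral_pushforward// preimage_setT.
transitivity (\int[mscale (NngNum cn0) (lebesgue_rV n)]_x f x)%E.
  by apply: eq_measure_integral => A mA _; exact: lebesgue_affine.
by rewrite ge0_integral_mscale.
Qed.

Lemma integrable_affine c t (f : 'rV[R]_n -> R) : 0 < c ->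
  (lebesgue_rV n).-integrable setT (EFin \o f) ->
  (lebesgue_rV n).-integrable setT (fun x => (f (c *: x + t))%:E).
Proof.
move=> c0 /integrableP[mf foo]; apply/integrableP; split.
  exact: (measurableT_comp mf (measurable_affine c t)).
rewrite (ge0_integral_affine t (f := fun x => `|(f x)%:E|%E))//; last first.
  exact: measurableT_comp.
by rewrite lte_mul_pinfty// lee_fin invr_ge0 exprn_ge0// ltW.
Qed.

Lemma integral_affine c t (f : 'rV[R]_n -> R) : 0 < c ->
  (lebesgue_rV n).-integrable setT (EFin \o f) ->
  (\int[lebesgue_rV n]_x (f (c *: x + t)%R)%:E =
   (c ^- n)%:E * \int[lebesgue_rV n]_x (f x)%:E)%E.
Proof.
move=> c0 fi; have mf := measurable_int _ fi.
rewrite integralE [in RHS]integralE muleBr//; last first.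
  by apply: fin_num_adde_defr; exact: (integrable_pos_fin_num measurableT fi).
rewrite -(ge0_integral_affine t (f := (EFin \o f)^\+%E))//; last first.
  exact: measurable_funepos.
rewrite -(ge0_integral_affine t (f := (EFin \o f)^\-%E))//.
  congr (_ - _)%E; apply: eq_integral => x _.
  - by rewrite !funeposE.
  - by rewrite !funenegE.
exact: measurable_funeneg.
Qed.

End boxes.

(** * Borel measurability of open sets and continuous functions *)

Section topology.
Context {R : realType} {n : nat}.

(** Links the topology with the sigma-algebra of the coordinates: an open set is the countable union
    of the boxes with rational corners that it contains. *)
Lemma measurable_open_rV (U : set 'rV[R]_n) : open U -> measurable U.
Proof.
move=> oU.
pose B (ab : 'rV[rat]_n * 'rV[rat]_n) : set 'rV[R]_n :=
  obox (map_mx ratr ab.1) (map_mx ratr ab.2).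
(* Boxes that leave [U] are replaced by [set0], so that the union runs over the whole countable type
   of rational corners. *)
pose F ab := if `[<B ab `<=` U>] then B ab else set0.
suff -> : U = \bigcup_ab F ab.
  apply: countable_bigcupT_measurable; first exact: countableP.
  by move=> ab; rewrite /F; case: ifP => // _; exact: measurable_obox.
apply/seteqP; split => [v Uv|v [ab _]]; last first.
  by rewrite /F; case: ifPn => [/asboolP h /h|].
have /nbhs_ballP[e /= e0 eU] := open_nbhs_nbhs (conj oU Uv).
have ra i : {q : rat | ratr q \in `]v ord0 i - e, v ord0 i[}.
  by apply: cid; have [|q] := @rat_in_itvoo R (v ord0 i - e) (v ord0 i);
    [rewrite ltrBlDr ltrDl|exists q].
have rb i : {q : rat | ratr q \in `]v ord0 i, v ord0 i + e[}.
  by apply: cid; have [|q] := @rat_in_itvoo R (v ord0 i) (v ord0 i + e);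
    [rewrite ltrDl|exists q].
pose ab := ((\row_i sval (ra i)) : 'rV[rat]_n, (\row_i sval (rb i)) : 'rV[rat]_n).
have Bv : B ab v.
  move=> i; rewrite /= in_itv/= !mxE.
  by have := svalP (ra i); have := svalP (rb i); rewrite !in_itv/= => /andP[-> _] /andP[_ ->].
exists ab => //; rewrite /F; case: ifPn => // /asboolPn; case => w Bw; apply: eU.
rewrite /ball/=; split=> // i j; rewrite (ord1 i) /ball/=.
move: (Bw j); rewrite /= in_itv/= !mxE /ball/= => /andP[].
have := svalP (ra j); have := svalP (rb j); rewrite !in_itv/= => /andP[_ h1] /andP[h2 _] h3 h4.
by rewrite ltr_norml; apply/andP; split; lra.
Qed.

Lemma continuous_measurable_rV (f : 'rV[R]_n -> R) :
  continuous f -> measurable_fun setT f.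
Proof.
move=> cf; apply: (measurability _ (RGenOpens.measurableE R)) => //.
move=> _ [_ [a [b ->]] <-]; rewrite setTI.
by apply: measurable_open_rV; apply: open_comp => //; exact: interval_open.
Qed.

End topology.

(** * Square integrability through plain integrals *)

Section L2.
Context d (T : measurableType d) (R : realType) (mu : {measure set T -> \bar R}).
Implicit Types f g : T -> R.

Definition sqint f : \bar R := \int[mu]_x (f x ^+ 2)%:E.

Lemma sqint_ge0 f : (0 <= sqint f)%E.
Proof. by apply: integral_ge0 => x _; rewrite lee_fin sqr_ge0. Qed.

(** Turns the squared norms in [mass] and [energy] into integrals, to which changes of variables and
    Tonelli apply. *)
Lemma sqr_Lnorm2 f : ('N[mu]_2%:E[EFin \o f] ^+ 2 = sqint f)%E.
Proof.
have -> : ('N[mu]_2%:E[EFin \o f] ^+ 2 = 'N[mu]_2%:E[EFin \o f] `^ 2%:R)%E.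
  case: (Lnorm _ _ _) (Lnorm_ge0 mu 2%:E (EFin \o f)) => [r||]//=.
    by rewrite lee_fin => r0; rewrite powR_mulrn.
  by move=> _; rewrite pnatr_eq0/= mulyy.
rewrite poweR_Lnorm//; apply: eq_integral => x _ /=.
by rewrite powR_mulrn// real_normK// num_real.
Qed.

Lemma Lfun2P f : f \in Lfun mu 2%:E <-> measurable_fun setT f /\ (sqint f < +oo)%E.
Proof.
split=> [fL|[mf foo]].
  have /integrableP[_] := Lfun2_integrable_sqr fL.
  under eq_integral do rewrite /= ger0_norm ?sqr_ge0//.
  by move: fL; rewrite inE => /andP[]; rewrite !inE.
rewrite inE; apply/andP; split; rewrite inE//=/finite_norm.
move: foo; rewrite -sqr_Lnorm2.
by case: (Lnorm _ _ _) (Lnorm_ge0 mu 2%:E (EFin \o f)) => [r _ _|//|//]; exact: ltry.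
Qed.

End L2.

(** * Test functions of product form *)

Section smooth1.
Context {R : realType}.
Implicit Types (f g : R -> R) (x : R) (P : {poly R}).

(** The one-variable counterpart of [Ck]. Continuity is asked for only at the last order; at lower
    orders it follows from differentiability. *)
Fixpoint smooth1 (k : nat) f : Prop :=
  if k is k'.+1 then (forall x, derivable f x 1) /\ smooth1 k' (derive1 f)
  else continuous f.

Lemma smooth1_intro k f f' :
  (forall x, is_derive x (1 : R) f (f' x)) -> smooth1 k f' -> smooth1 k.+1 f.
Proof.
move=> ff' sf' /=; split; first by move=> x; exact: ex_derive.
rewrite (_ : (derive1 f) = f')//; apply/funext => x.
by rewrite derive1E; exact: derive_val.
Qed.

Lemma smooth1_is_derive k f x : smooth1 k.+1 f -> is_derive x (1 : R) f ((derive1 f) x).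
Proof. by move=> [/(_ x) df _]; apply: DeriveDef => //; rewrite derive1E. Qed.

Lemma smooth1_continuous k f : smooth1 k f -> continuous f.
Proof.
case: k => // k [df _] x.
by apply: differentiable_continuous; exact/derivable1_diffP.
Qed.

Lemma smooth1S k f : smooth1 k.+1 f -> smooth1 k f.
Proof.
elim: k f => [|k IH] f; first exact: smooth1_continuous.
by move=> [df sf]; split => //; exact: IH.
Qed.

Lemma smooth1_cst k (c : R) : smooth1 k (fun=> c).
Proof.
elim: k c => [|k IH] c; first by move=> ?; exact: cvg_cst.
by apply: (smooth1_intro (f' := fun=> 0)) => // x; exact: is_derive_cst.
Qed.

Lemma smooth1D k f g : smooth1 k f -> smooth1 k g -> smooth1 k (fun x => f x + g x).
Proof.
elim: k f g => [f g cf cg x|k IH f g sf sg]; first by apply: continuousD; [exact: cf|exact: cg].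
apply: (smooth1_intro (f' := fun x => (derive1 f) x + (derive1 g) x)) => [x|].
  exact: (is_deriveD (smooth1_is_derive x sf) (smooth1_is_derive x sg)).
by apply: IH; [case: sf|case: sg].
Qed.

Lemma smooth1M k f g : smooth1 k f -> smooth1 k g -> smooth1 k (fun x => f x * g x).
Proof.
elim: k f g => [f g cf cg x|k IH f g sf sg]; first by apply: continuousM; [exact: cf|exact: cg].
apply: (smooth1_intro (f' := fun x => f x * (derive1 g) x + g x * (derive1 f) x)) => [x|].
  exact: (is_deriveM (smooth1_is_derive x sf) (smooth1_is_derive x sg)).
have sf1 := smooth1S sf; have sg1 := smooth1S sg.
by apply: smooth1D; apply: IH => //; [case: sg|case: sf].
Qed.

Lemma smooth1Z k c f : smooth1 k f -> smooth1 k (fun x => c * f x).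
Proof. by apply: smooth1M; exact: smooth1_cst. Qed.

Lemma is_derive1_affine c d x : is_derive x (1 : R) (fun y => c * y + d) c.
Proof.
have dZ : is_derive x (1 : R) ( *%R c : R -> R) (c *: (1 : R)).
  exact: (is_deriveZ c (is_derive_id x (1 : R))).
have := is_deriveD dZ (is_derive_cst d x (1 : R)).
by rewrite addr0 /GRing.scale/= mulr1.
Qed.

Lemma is_derive1_comp_affine c d x f df : is_derive (c * x + d) (1 : R) f df ->
  is_derive x (1 : R) (fun y => f (c * y + d)) (c * df).
Proof.
move=> dff; rewrite mulrC.
exact: (is_derive1_comp (g := fun y => c * y + d) dff (is_derive1_affine c d x)).
Qed.

Lemma smooth1_comp_affine k c d f : smooth1 k f -> smooth1 k (fun x => f (c * x + d)).
Proof.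
elim: k f => [f cf x|k IH f sf].
  apply: (continuous_comp (f := fun y => c * y + d)); last exact: cf.
  apply: differentiable_continuous; apply/derivable1_diffP.
  by have [] := is_derive1_affine c d x.
apply: (smooth1_intro (f' := fun x => c * (derive1 f) (c * x + d))) => [x|].
  exact: is_derive1_comp_affine (smooth1_is_derive _ sf).
by apply: smooth1Z; apply: IH; case: sf.
Qed.

(** For [P = 1] this is the classical flat function exp(-1/x). Polynomial factors in 1/x make the
    family closed under differentiation, whence smoothness by induction. *)
Definition pexp P x : R := if 0 < x then P.[x^-1] * expR (- x^-1) else 0.

Lemma pow_expRN (k : nat) (y : R) : 0 <= y -> y ^+ k * expR (- y) <= k`!%:R.
Proof.
move=> y0; rewrite expRN ler_pdivrMr ?expR_gt0//.
case: k => [|k]; first by rewrite expr0 fact0 mul1r (le_trans _ (expR_ge1Dx y))// lerDl.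
rewrite -ler_pdivrMl ?ltr0n ?fact_gt0// mulrC.
by apply: le_trans (expR_ge1Dxn k y0); rewrite lerDr.
Qed.

Lemma poly_expRN_bounded P : exists2 C : R, 0 <= C & forall y, 0 <= y -> `|P.[y]| * expR (- y) <= C.
Proof.
exists (\sum_(i < size P) `|P`_i| * i`!%:R); first by apply: sumr_ge0 => i _; rewrite mulr_ge0.
move=> y y0; rewrite horner_coef.
apply: (@le_trans _ _ ((\sum_(i < size P) `|P`_i * y ^+ i|) * expR (- y))).
  by rewrite ler_wpM2r ?expR_ge0// ler_norm_sum.
rewrite mulr_suml; apply: ler_sum => i _.
by rewrite normrM (ger0_norm (exprn_ge0 _ y0)) -mulrA ler_wpM2l// pow_expRN.
Qed.

(** From (P(1/x) exp(-1/x))' = x^-2 (P(1/x) - P'(1/x)) exp(-1/x). *)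
Definition dpexp P : {poly R} := 'X^2 * (P - P^`()).

Lemma is_derive_pexp P x : is_derive x (1 : R) (pexp P) (pexp (dpexp P) x).
Proof.
have [x0|x0|->] := ltgtP x 0.
- apply: (near_eq_is_derive (f := fun=> 0)).
    near=> y; rewrite /pexp ltNge (_ : y <= 0 = true)//.
    by apply/ltW; near: y; exact: lt_nbhsl.
  by rewrite /pexp ltNge ltW//=; exact: is_derive_cst.
- apply: (near_eq_is_derive (f := fun x => P.[x^-1] * expR (- x^-1))).
    near=> y; rewrite /pexp ifT//; near: y; exact: lt_nbhsr.
  rewrite /pexp x0.
  have dV : is_derive x (1 : R) (fun y => y^-1) (- x ^- 2).
    have -> : - x ^- 2 = - x ^- 2 *: (1 : R) by rewrite /GRing.scale/= mulr1.
    by apply: is_deriveV; rewrite gt_eqF.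
  have d1 := is_derive1_comp (is_derive_poly P x^-1) dV.
  have dNV : is_derive x (1 : R) (fun y : R => - y^-1) (- - x ^- 2) by exact: is_deriveN.
  have d2 := is_derive1_comp (g := fun y : R => - y^-1) (is_derive_expR (- x^-1)) dNV.
  apply: (is_derive_eq (is_deriveM d1 d2)).
  rewrite /GRing.scale/= /dpexp hornerM hornerXn hornerD hornerN.
  by rewrite -exprVn; ring.
(* At 0 the difference quotient is h^-1 P(1/h) exp(-1/h) = h (h^-2 P(1/h) exp(-1/h)). The bound is
   taken for ['X^2 * P] so that the bracket is at most [C] and the quotient is O(h). *)
- have [C C0 PC] := poly_expRN_bounded ('X^2 * P).
  have l0 : h^-1 *: ((pexp P \o shift 0) (h *: 1) - pexp P 0) @[h --> 0^'] --> (0 : R).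
    apply/cvgr0Pnorm_lt => e e0; near=> h.
    rewrite /= {2}/pexp ltxx subr0 addr0 /GRing.scale/= mulr1 /pexp.
    case: ifPn => [h0|_]; last by rewrite mulr0 normr0.
    have hV : h * h^-1 = 1 by rewrite mulfV// gt_eqF.
    have /PC : 0 <= h^-1 by rewrite invr_ge0 ltW.
    rewrite hornerM hornerXn normrM ger0_norm ?sqr_ge0// => PCh.
    rewrite !normrM (ger0_norm (expR_ge0 _)) ger0_norm ?invr_ge0 ?(ltW h0)//.
    have -> : h^-1 * (`|P.[h^-1]| * expR (- h^-1)) =
        h * (h^-1 ^+ 2 * `|P.[h^-1]| * expR (- h^-1)).
      by rewrite expr2 !mulrA hV mul1r.
    apply: (@le_lt_trans _ _ (h * C)); first by rewrite ler_wpM2l// ltW.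
    have : `|h| < e / (C + 1) by near: h; apply: dnbhs0_lt; rewrite divr_gt0// ltr_wpDl.
    rewrite gtr0_norm// ltr_pdivlMr ?ltr_wpDl//; apply: le_lt_trans.
    by rewrite ler_wpM2l ?(ltW h0)// lerDl.
  rewrite {2}/pexp ltxx; apply: DeriveDef; first by apply/cvg_ex; exists 0.
  by apply/cvg_lim.
Unshelve. all: end_near. Qed.

Lemma smooth1_pexp k P : smooth1 k (pexp P).
Proof.
elim: k P => [|k IH] P; last exact: (smooth1_intro (is_derive_pexp P)).
move=> x; apply: differentiable_continuous; apply/derivable1_diffP.
by have := is_derive_pexp P x => -[].
Qed.

End smooth1.

(** * Smooth bumps on the line *)

Section bumps.
Context {R : realType}.
Implicit Types (f g phi : R -> R) (a b h x : R).

Definition smooth f := forall k, smooth1 k f.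

Definition vanishes_outside a b f := forall x, ~~ (a < x < b) -> f x = 0.

(** One flat factor switches on at [a], the other switches off at [b]. The slope [m.+1] sends their
    arguments to infinity inside []a, b[], where the product tends to 1 while staying in [0, 1]. *)
Definition bump (m : nat) a b x : R :=
  pexp 1 (m.+1%:R * x + - (m.+1%:R * a)) * pexp 1 (- m.+1%:R * x + m.+1%:R * b).

Lemma smooth_bump m a b : smooth (bump m a b).
Proof.
by move=> k; apply: smooth1M; apply: smooth1_comp_affine; exact: smooth1_pexp.
Qed.

Lemma pexp1_ge0 x : 0 <= pexp 1 x.
Proof. by rewrite /pexp; case: ifP => // _; rewrite hornerC mul1r expR_ge0. Qed.

Lemma pexp1_le1 x : pexp 1 x <= 1.
Proof.
rewrite /pexp; case: ifP => // x0; rewrite hornerC mul1r -expR0 ler_expR.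
by rewrite oppr_le0 invr_ge0 ltW.
Qed.

Lemma bump_ge0 m a b x : 0 <= bump m a b x.
Proof. by rewrite mulr_ge0// pexp1_ge0. Qed.

Lemma bump_le1 m a b x : bump m a b x <= 1.
Proof. by rewrite mulr_ile1// ?pexp1_ge0// pexp1_le1. Qed.

Lemma bump_vanishes m a b : vanishes_outside a b (bump m a b).
Proof.
move=> x; rewrite /bump negb_and -!leNgt => /orP[xa|bx].
  rewrite [X in X * _](_ : _ = 0) ?mul0r// /pexp ltNge.
  by rewrite -mulrN -mulrDr pmulr_rle0// subr_le0 xa.
rewrite [X in _ * X](_ : _ = 0) ?mulr0// /pexp ltNge.
by rewrite mulNr addrC -mulrBr pmulr_rle0// subr_le0 bx.
Qed.

Lemma cvg_pexp1 x : 0 < x -> pexp 1 (m.+1%:R * x) @[m --> \oo] --> (1 : R).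
Proof.
move=> x0.
rewrite (_ : (fun m => _) = (fun m => expR (- (x^-1 * m.+1%:R^-1)))); last first.
  apply/funext => m; rewrite /pexp pmulr_rgt0// x0 hornerC mul1r.
  by rewrite invfM mulrC.
rewrite -[X in _ --> X]expR0 -oppr0 -(mulr0 x^-1).
apply: (cvg_comp (fun m : nat => - (x^-1 * m.+1%:R^-1)) expR); last first.
  exact: continuous_expR.
by apply: cvgN; apply: cvgMr => //; exact: cvg_harmonic.
Qed.

Lemma cvg_bump a b x : bump m a b x @[m --> \oo] --> (if a < x < b then 1 else 0 : R).
Proof.
case: ifPn => [/andP[ax xb]|/bump_vanishes nx]; last first.
  by under eq_cvg do rewrite nx; exact: cvg_cst.
rewrite -[X in _ --> X]mulr1; apply: cvgM.
  under eq_cvg do rewrite -mulrBr.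
  by apply: cvg_pexp1; rewrite subr_gt0.
under eq_cvg do rewrite mulNr addrC -mulrBr.
by apply: cvg_pexp1; rewrite subr_gt0.
Qed.

Lemma smooth_continuous f : smooth f -> continuous f.
Proof. by move=> /(_ 0%N). Qed.

Lemma smooth_derive f : smooth f -> smooth (derive1 f).
Proof. by move=> sf k; have [] := sf k.+1. Qed.

Lemma vanishes_bounded a b f : continuous f -> vanishes_outside a b f ->
  exists2 M, 0 <= M & forall x, `|f x| <= M.
Proof.
move=> cf vf.
have [ab|ba] := leP a b; last first.
  exists 0 => // x; rewrite vf ?normr0//; apply/negP => /andP[ax xb].
  by have := lt_trans ax xb; rewrite ltNge ltW.
have cnf : {within `[a, b], continuous (fun x => `|f x|)}.
  by apply: continuous_subspaceT => x; apply: cvg_norm; exact: cf.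
have [c _ fc] := EVT_max ab cnf.
exists `|f c| => // x; have [xab|xab] := boolP (x \in `[a, b]); first exact: fc.
rewrite vf ?normr0//; apply: contra xab => /andP[ax xb].
by rewrite in_itv/= !ltW.
Qed.

Lemma vanishes_integrable a b f : continuous f -> vanishes_outside a b f ->
  lebesgue_measure.-integrable setT (EFin \o f).
Proof.
move=> cf vf.
have -> : EFin \o f = (EFin \o f) \_ `[a, b].
  apply/funext => x; rewrite patchE; case: ifPn => // xab.
  rewrite /= vf//; apply: contra xab => /andP[ax xb].
  by rewrite inE/= in_itv/= !ltW.
rewrite -integrable_mkcond//.
apply: continuous_compact_integrable; first exact: segment_compact.
exact: continuous_subspaceT.
Qed.

Lemma smooth_primitive a b f : smooth f -> vanishes_outside a b f ->
  exists2 F, smooth F & forall x, is_derive x (1 : R) F (f x).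
Proof.
move=> sf vf; pose F x := (\int[lebesgue_measure]_(t in `]-oo, x]) f t)%R.
have dF x : is_derive x (1 : R) F (f x).
  have [] := @continuous_FTC1 R f (BInfty _ true) x (x + 1).
  - by rewrite ltrDl.
  - apply: (integrableS measurableT) => //.
    by apply: vanishes_integrable vf; exact: smooth_continuous.
  - by rewrite ltNyr.
  - exact: (smooth_continuous sf).
  by move=> dF F'; apply: DeriveDef => //; rewrite -F' derive1E.
exists F => // -[|k]; last exact: (smooth1_intro dF).
by apply: (@smooth1_continuous _ 1); apply: (smooth1_intro dF); exact: sf.
Qed.

(** With [F] a primitive of [f], the function [g x = F x - F (x - h)] is at once the average of [f]
    over a segment, up to the factor [h], and a function whose derivative is a difference of
    translates. It will replace one factor of a product test function. *)
Lemma smooth_shift_primitive a b h f : 0 < h -> smooth f -> vanishes_outside a b f ->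
  exists g, [/\ smooth g, vanishes_outside a (b + h) g,
    forall x, derive1 g x = f x - f (x - h) &
    forall x, (\int[lebesgue_measure]_(s in `[0%R, h]) (f (x - s))%:E = (g x)%:E)%E].
Proof.
move=> h0 sf vf; have [F sF dF] := smooth_primitive sf vf.
pose g x := F x + -1 * F (1 * x + - h).
pose G x s := -1 * F (-1 * s + x).
have sG x : smooth (G x).
  by move=> k; apply: smooth1Z; apply: smooth1_comp_affine; exact: sF.
have dG x s : is_derive s (1 : R) (G x) (f (x - s)).
  have d1 : is_derive s (1 : R) (fun s => F (-1 * s + x)) (-1 * f (-1 * s + x)).
    by apply: is_derive1_comp_affine; exact: dF.
  have := is_deriveZ (-1) d1.
  by rewrite /GRing.scale/= mulrA mulrNN !mul1r mulN1r addrC.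
have gE x : (\int[lebesgue_measure]_(s in `[0%R, h]) (f (x - s))%:E = (g x)%:E)%E.
  rewrite (continuous_FTC2 (F := G x))//.
  - rewrite -EFinB; apply: (congr1 EFin); rewrite /G /g.
    rewrite (_ : -1 * h + x = x - h); last by ring.
    by rewrite mulr0 add0r mul1r; ring.
  - apply: continuous_subspaceT; apply: smooth_continuous => k.
    have -> : (fun s => f (x - s)) = (fun s => f (-1 * s + x)).
      by apply/funext => s; rewrite mulN1r addrC.
    by apply: smooth1_comp_affine; exact: sf.
  - split; first by move=> s _; have [] := dG x s.
    + by apply: cvg_at_right_filter; exact: (smooth_continuous (sG x)).
    + by apply: cvg_at_left_filter; exact: (smooth_continuous (sG x)).
  - by move=> s _; rewrite derive1E; have [] := dG x s.
have sg : smooth g.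
  move=> k; apply: smooth1D; first exact: sF.
  by apply: smooth1Z; apply: smooth1_comp_affine; exact: sF.
exists g; split => //.
(* The support is read off the integral form: for [x] outside []a, b + h[], every [x - s] with [s]
   in [[0, h]] lies outside []a, b[]. *)
- move=> x nx; apply: EFin_inj; rewrite -gE; apply: integral0_eq => s.
  rewrite /= in_itv/= => /andP[s0 sh]; congr EFin; apply: vf.
  by apply: contra nx => /andP[h1 h2]; apply/andP; split; lra.
- move=> x; rewrite derive1E.
  have d1 : is_derive x (1 : R) (fun x => F (1 * x + - h)) (1 * f (1 * x + - h)).
    by apply: is_derive1_comp_affine; exact: dF.
  have [_] := is_deriveD (dF x) (is_deriveZ (-1) d1).
  by rewrite /GRing.scale/= mulN1r !mul1r.
Qed.

End bumps.

(** * Products of one-variable functions as test functions *)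

Section product_tests.
Context {R : realType} {n : nat}.
Implicit Types (phi : 'I_n -> R -> R) (x : 'rV[R]_n) (i : 'I_n).

Definition tensor phi x : R := \prod_i phi i (x ord0 i).

Definition set_factor i (g : R -> R) phi : 'I_n -> R -> R :=
  fun j => if j == i then g else phi j.

Lemma tensor_set_factor i g phi x :
  tensor (set_factor i g phi) x = g (x ord0 i) * \prod_(j | j != i) phi j (x ord0 j).
Proof.
rewrite /tensor (bigD1 i)//= /set_factor eqxx; congr (_ * _).
by apply: eq_bigr => j /negPf ->.
Qed.

Lemma set_factor_id i phi : set_factor i (phi i) phi = phi.
Proof. by apply/funext => j; rewrite /set_factor; case: eqP => // ->. Qed.

Lemma continuous_tensor phi : (forall i, continuous (phi i)) -> continuous (tensor phi).
Proof.
move=> cphi.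
suff cr (r : seq 'I_n) : continuous (fun y : 'rV[R]_n => \prod_(i <- r) phi i (y ord0 i)).
  exact: cr.
elim: r => [|i r IH].
  rewrite (_ : (fun _ => _) = cst 1); first exact: cst_continuous.
  by apply/funext => y; rewrite big_nil.
move=> y; rewrite (_ : (fun _ => _) =
    (fun y : 'rV[R]_n => phi i (y ord0 i) * \prod_(j <- r) phi j (y ord0 j))); last first.
  by apply/funext => z; rewrite big_cons.
apply: continuousM; last exact: IH.
 apply: (continuous_comp (f := fun x : 'rV[R]_n => x ord0 i)); last exact: cphi.
exact: coord_continuous.
Qed.

Lemma is_derive_tensor phi x i : (forall y, derivable (phi i) y 1) ->
  is_derive x (delta_mx ord0 i) (tensor phi) (tensor (set_factor i (derive1 (phi i)) phi) x).
Proof.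
move=> dphi; set l := tensor (set_factor _ _ _) x.
have hl : h^-1 *: ((tensor phi \o shift x) (h *: delta_mx ord0 i) - tensor phi x)
    @[h --> 0^'] --> l.
  rewrite /l tensor_set_factor.
  set C := \prod_(j | _) _.
  have -> : (fun h => h^-1 *: ((tensor phi \o shift x) (h *: delta_mx ord0 i) - tensor phi x)) =
    (fun h => h^-1 *: ((phi i \o shift (x ord0 i)) (h *: (1 : R)) - phi i (x ord0 i)) * C).
    apply/funext => h; rewrite -{1 2}(set_factor_id i phi) /= !tensor_set_factor -/C.
    rewrite [X in _ * X - _](_ : _ = C); last first.
      by apply: eq_bigr => j ji; rewrite !mxE (negPf ji) andbF mulr0 add0r.
    by rewrite !mxE !eqxx -mulrBl scalerAl.
  apply: cvgMl; rewrite derive1E.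
  by have /cvg_ex[k /[dup] hk /cvg_lim] := dphi (x ord0 i); rewrite /derive => ->.
apply: DeriveDef; first by apply/cvg_ex; exists l.
exact/cvg_lim.
Qed.

Lemma partial_tensor phi i : (forall y, derivable (phi i) y 1) ->
  partial i (tensor phi) = tensor (set_factor i (derive1 (phi i)) phi).
Proof.
by move=> dphi; apply/funext => x; rewrite /partial; have [_ ->] := is_derive_tensor x dphi.
Qed.

(** The induction closes because a partial derivative of a product is again such a product, with one
    factor differentiated. *)
Lemma Ck_tensor k phi : (forall i, smooth (phi i)) -> Ck k (tensor phi).
Proof.
elim: k phi => [|k IH] phi sphi /=; split => //.
- by apply: continuous_tensor => i; exact: smooth_continuous.
- by apply: continuous_tensor => i; exact: smooth_continuous.
move=> i; have dphi y : derivable (phi i) y 1 by have [] := sphi i 1%N.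
split; first by move=> x; have [] := is_derive_tensor x dphi.
rewrite partial_tensor//; apply: IH => j; rewrite /set_factor; case: ifP => // _.
exact: smooth_derive.
Qed.

Definition tensor_test (a b : 'rV[R]_n) phi : Prop :=
  forall i, smooth (phi i) /\ vanishes_outside (a ord0 i) (b ord0 i) (phi i).

Lemma tensor_test_vanishes a b phi x : tensor_test a b phi -> ~ obox a b x -> tensor phi x = 0.
Proof.
move=> tphi /existsNP[i nx]; rewrite /tensor (bigD1 i)//= (tphi i).2 ?mul0r//.
by apply/negP; move: nx; rewrite /= in_itv.
Qed.

Lemma test_function_tensor a b phi : tensor_test a b phi -> test_function (tensor phi).
Proof.
move=> tphi; split; first by move=> k; apply: Ck_tensor => i; exact: (tphi i).1.
have cK := @rV_compact R n (fun i => `[a ord0 i, b ord0 i]%classic)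
  (fun i => @segment_compact _ _ _).
apply: (subclosed_compact _ cK); first exact: closed_closure.
rewrite [X in _ `<=` X](closure_id _).1; last first.
  by apply: compact_closed => //; exact: norm_hausdorff.
apply: closure_subset => x /= phix i.
have [xB|/(tensor_test_vanishes tphi) t0] := pselect (obox a b x); last by rewrite t0 eqxx in phix.
by have := xB i; rewrite /= !in_itv/= => /andP[h1 h2]; rewrite !ltW.
Qed.

Lemma measurable_tensor a b phi : tensor_test a b phi -> measurable_fun setT (tensor phi).
Proof.
move=> tphi; apply: continuous_measurable_rV; apply: continuous_tensor => i.
exact: smooth_continuous (tphi i).1.
Qed.

Lemma tensor_bounded a b phi : tensor_test a b phi ->
  exists2 M, 0 <= M & forall x, `|tensor phi x| <= M.
Proof.
move=> tphi.
have /choice[M hM] : forall i, exists M : R, 0 <= M /\ forall y : R, `|phi i y| <= M.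
  move=> i.
  by have [M M0 hM] := vanishes_bounded (smooth_continuous (tphi i).1) (tphi i).2; exists M.
exists (\prod_i M i); first by apply: prodr_ge0 => i _; exact: (hM i).1.
move=> x; rewrite /tensor normr_prod; apply: ler_prod => i _.
by rewrite normr_ge0 (hM i).2.
Qed.

End product_tests.

(** * The fundamental lemma of the calculus of variations *)

(** Packages an integral as a measure, so that uniqueness of measures can be applied to the two
    parts of a signed function. *)
Lemma density_measure d (T : measurableType d) (R : realType)
    (mu : {measure set T -> \bar R}) (f : T -> \bar R) :
  measurable_fun setT f -> (forall x, 0 <= f x)%E ->
  exists nu : {measure set T -> \bar R}, forall A, nu A = (\int[mu]_(x in A) f x)%E.
Proof.
move=> mf f0; pose nu A := (\int[mu]_(x in A) f x)%E.
have nu0 : nu set0 = 0%E by exact: integral_set0.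
have nu_ge0 A : (0 <= nu A)%E by exact: integral_ge0.
have nu_sigma : semi_sigma_additive nu by exact: semi_sigma_additive_nng_induced.
have nuM := isMeasure.Build _ _ _ nu nu0 nu_ge0 nu_sigma.
pose nu' : {measure set T -> \bar R} := HB.pack nu nuM.
by exists nu'.
Qed.

Section fundamental_lemma.
Context {R : realType} {n : nat}.
Local Notation mu := (lebesgue_rV n).
Implicit Types (a b : 'rV[R]_n) (H : 'rV[R]_n -> R).

Lemma cvg_tensor_bump a b x : obox a b x ->
  tensor (fun i => bump m (a ord0 i) (b ord0 i)) x @[m --> \oo] --> (1 : R).
Proof.
move=> Bx; pose u i m := bump m (a ord0 i) (b ord0 i) (x ord0 i).
have cu i : u i @ \oo --> (1 : R).
  have := Bx i; rewrite /= in_itv/= => axb.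
  by have := @cvg_bump _ (a ord0 i) (b ord0 i) (x ord0 i); rewrite axb.
suff cr (r : seq 'I_n) : (fun m => \prod_(i <- r) u i m) @ \oo --> (1 : R) by exact: cr.
elim: r => [|i r IH].
  by under eq_fun do rewrite big_nil; exact: cvg_cst.
under eq_fun do rewrite big_cons.
rewrite -[X in nbhs X]mulr1; exact: (cvgM (cu i) IH).
Qed.

(** Local, because the averages [fine (ray ...)] below are controlled on boxes only: their bound
    contains a constant term. *)
Definition locally_int H :=
  measurable_fun setT H /\ forall a b, mu.-integrable (obox a b) (EFin \o H).

(** The products of bumps converge to 1 on the box and are dominated there by 1, so dominated
    convergence applies with majorant [|H|]. *)
Lemma integral_obox_eq0 H a b : locally_int H ->
  (forall phi, tensor_test a b phi -> (\int[mu]_x (H x * tensor phi x)%:E = 0)%E) ->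
  (\int[mu]_(x in obox a b) (H x)%:E = 0)%E.
Proof.
move=> [mH iH] H0.
pose phi m i := bump m (a ord0 i) (b ord0 i).
have tphi m : tensor_test a b (phi m).
  by move=> i; split; [exact: smooth_bump|exact: bump_vanishes].
pose F m x := (H x * tensor (phi m) x)%:E.
have mF m : measurable_fun setT (F m).
  by apply/measurable_EFinP; apply: measurable_funM => //; exact: measurable_tensor (tphi m).
have F0 m : (\int[mu]_(x in obox a b) F m x = 0)%E.
  rewrite -(H0 _ (tphi m)) [LHS]integral_mkcond; apply: eq_integral => x _.
  rewrite patchE; case: ifPn => //; rewrite notin_setE => nB.
  by rewrite (tensor_test_vanishes (tphi m) nB) mulr0.
have [|||||_ _] := @dominated_convergence _ _ _ mu (obox a b) (measurable_obox a b)
  F (EFin \o H) (fun x => `|(H x)%:E|%E).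
- by move=> m; exact/measurable_funTS.
- exact: measurable_int (iH a b).
- apply: aeW => x Bx; rewrite /F; apply/cvg_EFin; first exact: nearW.
  rewrite /= -[X in _ --> X]mulr1; apply: cvgM; first exact: cvg_cst.
  by apply: cvg_tensor_bump.
- exact: integrable_abse.
- apply: aeW => x m Bx; rewrite /F lee_fin normrM ler_piMr//.
  rewrite /tensor normr_prod prodr_ile1// => i _; rewrite normr_ge0/=.
  by rewrite ger0_norm ?bump_ge0// bump_le1.
move/cvg_lim => <-//; apply/cvg_lim => //; apply: cvg_near_cst; apply: nearW => m /=.
exact: F0.
Qed.

(** The integrals of [H^+] and [H^-] agree and are finite on every box, so the two density measures
    coincide on all Borel sets. *)
Lemma ae_eq0_tensor H : locally_int H ->
  (forall a b phi, tensor_test a b phi -> (\int[mu]_x (H x * tensor phi x)%:E = 0)%E) ->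
  {ae mu, forall x, H x = 0}.
Proof.
move=> LH H0; have [mH iH] := LH.
have mE : measurable_fun setT (EFin \o H) by exact/measurable_EFinP.
have [nup nupE] := density_measure mu (measurable_funepos mE) (funepos_ge0 _).
have [num numE] := density_measure mu (measurable_funeneg mE) (funeneg_ge0 _).
have pfin a b : (\int[mu]_(x in obox a b) (EFin \o H)^\+ x \is a fin_num)%E.
  by apply: integrable_pos_fin_num; [exact: measurable_obox|exact: iH].
have nfin a b : (\int[mu]_(x in obox a b) (EFin \o H)^\- x \is a fin_num)%E.
  by apply: integrable_neg_fin_num; [exact: measurable_obox|exact: iH].
have pn A : measurable A -> nup A = num A.
  apply: measure_rV_unique => [a b|k]; last first.
    by rewrite nupE ltey_eq; apply/orP; left; exact: pfin.
  have := integral_obox_eq0 LH (H0 a b); rewrite integralE nupE numE => /eqP.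
  by rewrite sube_eq ?add0e ?fin_num_adde_defr// => /eqP.
(* Inside a cube both parts have finite integral, so the difference of the two equal integrals
   really is 0; the cubes then exhaust the space. *)
have aek k : {ae mu, forall x, cube k x -> (H x)%:E = 0%E}.
  apply: (@integral_ae_eq _ _ _ mu (cube k) (measurable_obox _ _) (cst 0%E)) => //.
  - exact: iH.
  - move=> E Ek mEE; rewrite integral0 integralE; have := pn _ mEE.
    rewrite nupE numE => ->; rewrite subee//.
    rewrite ge0_fin_numE ?integral_ge0//.
    apply: (@le_lt_trans _ _ (\int[mu]_(x in cube k) (EFin \o H)^\- x)%E).
      apply: ge0_subset_integral => //; first exact: measurable_obox.
      exact/measurable_funTS/measurable_funeneg.
    by rewrite ltey_eq; apply/orP; left; exact: nfin.
have := ae_foralln aek; apply: filterS => x xk.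
have [k _ kx] : (\bigcup_k cube k) x by rewrite bigcup_cube.
by have [] := xk k kx.
Qed.

End fundamental_lemma.

(** * Translations, square integrable tests and uniqueness of weak gradients *)

Section shifts.
Context {R : realType} {n : nat}.
Local Notation mu := (lebesgue_rV n).
Implicit Types (a b t x : 'rV[R]_n) (u : 'rV[R]_n -> R).

Lemma measurable_shift t : measurable_fun setT (fun x => x + t).
Proof.
have := measurable_affine 1 t; congr (measurable_fun _ _).
by apply/funext => x; rewrite /affine scale1r.
Qed.

Lemma lebesgue_shift t A : measurable A -> mu [set x | A (x + t)] = mu A.
Proof.
move=> mA; have := lebesgue_affine t ltr01 mA.
rewrite expr1n invr1 mul1e => <-; congr (mu _).
by apply/funext => x; rewrite /= /affine scale1r.
Qed.

Lemma ge0_integral_shift t (f : 'rV[R]_n -> \bar R) :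
  measurable_fun setT f -> (forall x, 0 <= f x)%E ->
  (\int[mu]_x f (x + t)%R = \int[mu]_x f x)%E.
Proof.
move=> mf f0; have := ge0_integral_affine t ltr01 mf f0.
by rewrite expr1n invr1 mul1e => <-; apply: eq_integral => x _; rewrite scale1r.
Qed.

Lemma integral_shift t u : mu.-integrable setT (EFin \o u) ->
  (\int[mu]_x (u (x + t)%R)%:E = \int[mu]_x (u x)%:E)%E.
Proof.
move=> fi; have := integral_affine t ltr01 fi.
by rewrite expr1n invr1 mul1e => <-; apply: eq_integral => x _; rewrite scale1r.
Qed.

Lemma Lfun2_shift t u : u \in Lfun mu 2%:E -> (fun x => u (x + t)) \in Lfun mu 2%:E.
Proof.
move=> /Lfun2P[mu_ uoo]; apply/Lfun2P; split.
  exact: (measurableT_comp mu_ (measurable_shift t)).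
rewrite /sqint (ge0_integral_shift t (f := fun x => (u x ^+ 2)%:E))//.
- by apply/measurable_EFinP; exact: measurable_funX.
- by move=> x; rewrite lee_fin sqr_ge0.
Qed.

Lemma Lfun2_bounded u A M : measurable A -> (mu A < +oo)%E -> measurable_fun setT u ->
  (forall x, `|u x| <= M) -> (forall x, ~ A x -> u x = 0) -> u \in Lfun mu 2%:E.
Proof.
move=> mA Aoo mu_ uM u0; apply/Lfun2P; split => //.
apply: (@le_lt_trans _ _ (\int[mu]_(x in A) (M ^+ 2)%:E)%E); last first.
  by rewrite integral_cst// lte_mul_pinfty// lee_fin sqr_ge0.
rewrite /sqint [leRHS]integral_mkcond; apply: ge0_le_integral => //.
- by move=> x _; rewrite lee_fin sqr_ge0.
- by apply/measurable_EFinP; exact: measurable_funX.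
- by apply/(measurable_restrictT _ mA); exact: measurable_cst.
move=> x _; rewrite patchE; case: ifPn => [xA|]; last first.
  by rewrite notin_setE => /u0 ->; rewrite expr0n.
by rewrite lee_fin -real_normK ?num_real// lerXn2r// ?nnegrE// (le_trans _ (uM x)).
Qed.

Lemma Lfun2_tensor a b phi : tensor_test a b phi -> tensor phi \in Lfun mu 2%:E.
Proof.
move=> tphi; have [M _ phiM] := tensor_bounded tphi.
apply: (Lfun2_bounded (measurable_obox a b) (obox_lty a b) _ phiM).
- exact: measurable_tensor tphi.
- by move=> x; exact: tensor_test_vanishes.
Qed.

Lemma Lfun2_indic_obox a b : (\1_(obox a b) : 'rV[R]_n -> R) \in Lfun mu 2%:E.
Proof.
apply: (Lfun2_bounded (M := 1) (measurable_obox a b) (obox_lty a b)).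
- exact: measurable_indic (measurable_obox a b).
- by move=> x; rewrite indicE; case: (_ \in _); rewrite ?normr1 ?normr0.
- by move=> x nx; rewrite indicE memNset.
Qed.

Lemma Lfun2_integrableM u v : u \in Lfun mu 2%:E -> v \in Lfun mu 2%:E ->
  mu.-integrable setT (fun x => (u x * v x)%:E).
Proof. by move=> uL vL; exact/Lfun1_integrable/Lfun2_mul_Lfun1. Qed.

Lemma Lfun2_locally_int u : u \in Lfun mu 2%:E -> locally_int u.
Proof.
move=> uL; split=> [|a b]; first by have /Lfun2P[] := uL.
rewrite (integrable_mkcond _ (measurable_obox a b)).
apply: eq_integrable (Lfun2_integrableM uL (Lfun2_indic_obox a b)) => // x _.
by rewrite patchE indicE; case: (_ \in _); rewrite ?mulr1 ?mulr0.
Qed.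

Lemma locally_intB u v : locally_int u -> locally_int v -> locally_int (fun x => u x - v x).
Proof.
move=> [mu_ iu] [mv iv]; split; first exact: measurable_funB.
by move=> a b; exact: (integrableB (measurable_obox a b) (iu a b) (iv a b)).
Qed.

Lemma weak_grad_tensor u g i a b phi : is_weak_grad u g -> tensor_test a b phi ->
  (\int[mu]_x (u x * tensor (set_factor i (derive1 (phi i)) phi) x)%:E =
   - \int[mu]_x (g x ord0 i * tensor phi x)%:E)%E.
Proof.
move=> ug tphi; rewrite -ug; last exact: test_function_tensor tphi.
by rewrite partial_tensor// => y; have [] := (tphi i).1 1%N.
Qed.

(** Allows any explicit weak gradient to stand in for the chosen [weak_grad]. *)
Lemma weak_grad_unique u g g' i : L2_weak_grad u g -> L2_weak_grad u g' ->
  {ae mu, forall x, g x ord0 i = g' x ord0 i}.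
Proof.
move=> [gL ug] [g'L ug'].
have LH : locally_int (fun x => g x ord0 i - g' x ord0 i).
  by apply: locally_intB; apply: Lfun2_locally_int.
have := ae_eq0_tensor LH.
have H0 a b phi : tensor_test a b phi ->
    (\int[mu]_x ((g x ord0 i - g' x ord0 i) * tensor phi x)%:E = 0)%E.
  move=> tphi; have phiL := Lfun2_tensor tphi.
  under eq_integral do rewrite mulrBl EFinB.
  rewrite integralB//; try exact: Lfun2_integrableM.
  have := weak_grad_tensor i ug tphi; rewrite (weak_grad_tensor i ug' tphi).
  move=> /oppe_inj ->; rewrite subee//.
  exact: (integrable_fin_num measurableT (Lfun2_integrableM (gL i) phiL)).
move=> /(_ H0); apply: filterS => x /eqP; rewrite subr_eq0 => /eqP//.
Qed.

End shifts.

(** * Increments of a function with a weak gradient *)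

Section rays.
Context {R : realType} {n : nat} (h : R) (v : 'rV[R]_n).
Hypothesis h_gt0 : 0 < h.
Local Notation mu := (lebesgue_rV n).
Local Notation L := (@lebesgue_measure R).
Local Notation chi := (\1_(`[0, h]%classic : set R)).
Implicit Types (x : 'rV[R]_n) (f u : 'rV[R]_n -> R).

(* [h] times the average of [f] over the segment from [x] to [x + h v]. *)
Definition ray f x : \bar R := \int[L]_s (f (x + s *: v) * chi s)%:E.

Lemma chi_ge0 (s : R) : 0 <= chi s :> R.
Proof. by rewrite indicE. Qed.

Lemma measurable_chi : measurable_fun setT (fun s : R => chi s : R).
Proof. exact: measurable_indic. Qed.

Lemma integral_cst_chi (c : R) : 0 <= c -> (\int[L]_s (c * chi s)%:E = (c * h)%:E)%E.
Proof.
move=> c0; transitivity (\int[L]_(s in `[0%R, h]) (cst c%:E) s)%E.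
  rewrite [RHS]integral_mkcond; apply: eq_integral => s _.
  by rewrite patchE indicE; case: (_ \in _); rewrite ?mulr1 ?mulr0.
by rewrite integral_cst//= lebesgue_measure_itv/= lte_fin h_gt0 -EFinB subr0.
Qed.

Lemma measurable_ray_kernel f (w : 'rV[R]_n) : measurable_fun setT f ->
  measurable_fun setT (fun z : 'rV[R]_n * measurableTypeR R => f (z.1 + z.2 *: w)).
Proof.
move=> mf.
have mg : measurable_fun setT (fun z : 'rV[R]_n * measurableTypeR R => z.1 + z.2 *: w).
  apply: measurable_fun_rV => j; under eq_fun do rewrite !mxE.
  apply: measurable_funD.
    exact: (measurableT_comp (measurable_coord j) measurable_fst).
  by apply: measurable_funM => //; exact: measurable_snd.
exact: (measurableT_comp mf mg).
Qed.

Lemma measurable_ray_chi (F : 'rV[R]_n * measurableTypeR R -> R) : measurable_fun setT F ->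
  measurable_fun setT (fun z => (F z * chi z.2)%:E).
Proof.
move=> mF; apply/measurable_EFinP; apply: measurable_funM => //.
exact: (measurableT_comp measurable_chi measurable_snd).
Qed.

(** Tonelli: for each [s] in [[0, h]] the translate by [s *: v] has the same integral as [f]. *)
Lemma integral_ray f : measurable_fun setT f -> (forall x, 0 <= f x) ->
  (\int[mu]_x ray f x = h%:E * \int[mu]_x (f x)%:E)%E.
Proof.
move=> mf f0; rewrite /ray.
rewrite (fubini_tonelli (m1 := mu) (m2 := L)
  (fun z : 'rV[R]_n * measurableTypeR R => (f (z.1 + z.2 *: v) * chi z.2)%:E))/=; last 2 first.
- by apply: measurable_ray_chi; exact: measurable_ray_kernel.
- by move=> z; rewrite lee_fin mulr_ge0// chi_ge0.
transitivity (\int[L]_s ((\int[mu]_x (f x)%:E) * (chi s)%:E))%E.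
  apply: eq_integral => s _.
  under eq_integral do rewrite EFinM.
  rewrite ge0_integralZr//.
  - congr (_ * _)%E; apply: (ge0_integral_shift _ (f := EFin \o f)) => //.
    exact/measurable_EFinP.
  - by apply/measurable_EFinP; exact: (measurableT_comp mf (measurable_shift _)).
  - by move=> x _; rewrite lee_fin.
rewrite ge0_integralZl//.
- rewrite muleC; have := integral_cst_chi ler01; rewrite mul1r => <-.
  by congr (_ * _)%E; apply: eq_integral => s _; rewrite mul1r.
- by apply/measurable_EFinP; exact: measurable_chi.
- by apply: integral_ge0 => x _; rewrite lee_fin.
Qed.

Lemma measurable_ge0_ray f : measurable_fun setT f -> (forall x, 0 <= f x) ->
  measurable_fun setT (ray f).
Proof.
move=> mf f0; apply: (measurable_fun_fubini_tonelli_F (m2 := L)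
  (fun z : 'rV[R]_n * measurableTypeR R => (f (z.1 + z.2 *: v) * chi z.2)%:E)).
- by apply: measurable_ray_chi; exact: measurable_ray_kernel.
- by move=> z; rewrite lee_fin mulr_ge0// chi_ge0.
Qed.

Lemma ray_slice_measurable f x : measurable_fun setT f ->
  measurable_fun setT (fun s : measurableTypeR R => (f (x + s *: v) * chi s)%:E).
Proof.
move=> mf; apply/measurable_EFinP; apply: measurable_funM; last exact: measurable_chi.
exact: (measurableT_comp (measurable_ray_kernel v mf) (measurable_pair1 x)).
Qed.

Lemma rayE f x : ray f x = (ray (f^\+)%R x - ray (f^\-)%R x)%E.
Proof.
rewrite /ray integralE; congr (_ - _)%E; apply: eq_integral => s _.
  rewrite funeposE /funrpos indicE; case: (_ \in _).
    by rewrite !mulr1 EFin_max.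
  by rewrite !mulr0 maxxx.
rewrite funenegE /funrneg indicE; case: (_ \in _).
  by rewrite !mulr1 EFin_max EFinN.
by rewrite !mulr0 oppe0 maxxx.
Qed.

Lemma measurable_ray f : measurable_fun setT f -> measurable_fun setT (ray f).
Proof.
move=> mf; rewrite (_ : ray f = ray (f^\+)%R \- ray (f^\-)%R)%E; last first.
  by apply/funext => x; rewrite rayE.
apply: emeasurable_funB; apply: measurable_ge0_ray.
- exact: measurable_funrpos.
- by move=> x; exact: funrpos_ge0.
- exact: measurable_funrneg.
- by move=> x; exact: funrneg_ge0.
Qed.

(* [fine] is [0] at infinite values, so this also holds at the points [x] where
   [f] is not integrable along the segment. *)
Lemma fine_ray_le f x : measurable_fun setT f ->
  (`|fine (ray f x)|%:E <= ray (fun y => `|f y|%R) x)%E.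
Proof.
move=> mf.
have abs_le : (`|ray f x| <= ray (fun y => `|f y|%R) x)%E.
  rewrite /ray; apply: (le_trans (le_abse_integral _ _ _)) => //.
    exact: ray_slice_measurable.
  under eq_integral do rewrite /= normrM (ger0_norm (chi_ge0 _)).
  exact: lexx.
have [fin|nfin] := boolP (ray f x \is a fin_num).
  by move: abs_le; rewrite -{1}(fineK fin).
have -> : fine (ray f x) = 0 by case: (ray f x) nfin.
rewrite normr0.
by apply: integral_ge0 => s _; rewrite lee_fin mulr_ge0// chi_ge0.
Qed.

(** Young's inequality |y| <= c / 2 + y^2 / (2 c), integrated along the segment. The free [c] is 1
    for local integrability and is tuned to the level in the superlevel estimate. *)
Lemma ray_abs_le f x (c : R) : measurable_fun setT f -> 0 < c ->
  (ray (fun y => `|f y|%R) x <= (2^-1 * c * h)%:E + (2 * c)^-1%:E * ray (fun y => f y ^+ 2)%R x)%E.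
Proof.
move=> mf c0.
have mf2 : measurable_fun setT (fun y => f y ^+ 2) by exact: measurable_funX.
have maf : measurable_fun setT (fun y => `|f y|) by exact: measurableT_comp.
have c2 : 0 <= (2 * c)^-1 by rewrite invr_ge0 mulr_ge0// ltW.
have hc : 0 <= 2^-1 * c by rewrite mulr_ge0// ltW.
rewrite -(integral_cst_chi hc) -ge0_integralZl//; last 2 first.
- exact: (ray_slice_measurable x mf2).
- by move=> s _; rewrite lee_fin mulr_ge0 ?sqr_ge0// chi_ge0.
rewrite -ge0_integralD//; last 4 first.
- by move=> s _; rewrite lee_fin mulr_ge0// chi_ge0.
- apply/measurable_EFinP; apply: measurable_funM => //; exact: measurable_chi.
- by move=> s _; rewrite mule_ge0// lee_fin mulr_ge0 ?sqr_ge0// chi_ge0.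
- exact: (measurable_funeM _ (ray_slice_measurable x mf2)).
apply: ge0_le_integral => //.
- exact: (ray_slice_measurable x maf).
- apply: emeasurable_funD.
    apply/measurable_EFinP; apply: measurable_funM => //; exact: measurable_chi.
  exact: (measurable_funeM _ (ray_slice_measurable x mf2)).
move=> s _; rewrite -EFinM -EFinD lee_fin mulrA -mulrDl ler_wpM2r ?chi_ge0//.
set y := f _; rewrite -subr_ge0.
have -> : 2^-1 * c + (2 * c)^-1 * y ^+ 2 - `|y| = (2 * c)^-1 * (c - `|y|) ^+ 2.
  by rewrite -(real_normK (num_real y)); field; rewrite gt_eqF.
by rewrite mulr_ge0 ?sqr_ge0.
Qed.

End rays.

Section translation.
Context {R : realType} {n : nat} (h : R).
Hypothesis h_gt0 : 0 < h.
Local Notation mu := (lebesgue_rV n).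
Local Notation L := (@lebesgue_measure R).
Local Notation chi := (\1_(`[0, h]%classic : set R)).
Implicit Types (x : 'rV[R]_n) (f g u : 'rV[R]_n -> R).

Lemma Lfun2_measurable f : f \in Lfun mu 2%:E -> measurable_fun setT f.
Proof. by move=> /Lfun2P[]. Qed.

Lemma integral_norm_mul_le f g : f \in Lfun mu 2%:E -> g \in Lfun mu 2%:E ->
  (\int[mu]_x `|f x * g x|%:E <= sqint mu f + sqint mu g)%E.
Proof.
move=> /Lfun2P[mf _] /Lfun2P[mg _].
rewrite /sqint -ge0_integralD//; last 4 first.
- by move=> x _; rewrite lee_fin sqr_ge0.
- by apply/measurable_EFinP; exact: measurable_funX.
- by move=> x _; rewrite lee_fin sqr_ge0.
- by apply/measurable_EFinP; exact: measurable_funX.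
apply: ge0_le_integral => //.
- by apply/measurable_EFinP; apply: measurableT_comp => //; exact: measurable_funM.
- by apply: emeasurable_funD; apply/measurable_EFinP; exact: measurable_funX.
move=> x _; rewrite -EFinD lee_fin normrM.
rewrite -(real_normK (num_real (f x))) -(real_normK (num_real (g x))).
have := sqr_ge0 (`|f x| - `|g x|); have := normr_ge0 (f x); have := normr_ge0 (g x).
set p := `|f x|; set q := `|g x|; nra.
Qed.

Lemma sqint_shift t f : measurable_fun setT f -> sqint mu (fun x => f (x + t)) = sqint mu f.
Proof.
move=> mf; rewrite /sqint (ge0_integral_shift t (f := fun x => (f x ^+ 2)%:E))//.
- by apply/measurable_EFinP; exact: measurable_funX.
- by move=> x; rewrite lee_fin sqr_ge0.
Qed.

(** The joint integrability required by Fubini. For fixed [s], translation invariance bounds the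
    integral in [x] by the sum of the two square integrals, uniformly in [s], and [chi] keeps [s] in
    a segment of length [h]. *)
Lemma integrable_ray_prod f g (w : 'rV[R]_n) : f \in Lfun mu 2%:E -> g \in Lfun mu 2%:E ->
  (mu \x L)%E.-integrable setT
    (fun z : 'rV[R]_n * measurableTypeR R => (f z.1 * g (z.1 + z.2 *: w) * chi z.2)%:E).
Proof.
move=> fL gL; have [mf foo] := (Lfun2P mu f).1 fL; have [mg goo] := (Lfun2P mu g).1 gL.
have mF : measurable_fun setT
    (fun z : 'rV[R]_n * measurableTypeR R => (f z.1 * g (z.1 + z.2 *: w) * chi z.2)%:E).
  apply: (measurable_ray_chi h (F := fun z => f z.1 * g (z.1 + z.2 *: w))).
  apply: measurable_funM; last exact: measurable_ray_kernel.
  exact: (measurableT_comp mf measurable_fst).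
apply/(integrable21ltyP mu L mF).
have fin : (sqint mu f + sqint mu g)%E \is a fin_num.
  by rewrite fin_numD !ge0_fin_numE ?sqint_ge0// foo.
pose C := fine (sqint mu f + sqint mu g).
have C0 : 0 <= C by rewrite fine_ge0// adde_ge0// sqint_ge0.
apply: (@le_lt_trans _ _ (\int[L]_s (C * chi s)%:E)%E); last first.
  by rewrite integral_cst_chi// ltry.
apply: ge0_le_integral => //.
- by move=> s _; exact: integral_ge0.
- apply: (measurable_fun_fubini_tonelli_G (m1 := mu) (fun z : 'rV[R]_n * measurableTypeR R =>
    `|(f z.1 * g (z.1 + z.2 *: w) * chi z.2)%:E|%E)) => //.
  exact: measurableT_comp.
- apply/measurable_EFinP; apply: measurable_funM => //; exact: measurable_chi.
move=> s _ /=.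
have gsL := Lfun2_shift (s *: w) gL.
have ms : measurable_fun setT (fun x => `|f x * g (x + s *: w)|%:E).
  apply/measurable_EFinP; apply: measurableT_comp => //; apply: measurable_funM => //.
  exact: Lfun2_measurable.
under eq_integral do rewrite normrM (ger0_norm (chi_ge0 h s)) EFinM.
rewrite ge0_integralZr//.
rewrite EFinM /C fineK//; apply: lee_wpmul2r; first by rewrite lee_fin chi_ge0.
by rewrite -(sqint_shift (s *: w) mg); exact: integral_norm_mul_le.
Qed.

Lemma integral_ray_mul f g (w : 'rV[R]_n) : f \in Lfun mu 2%:E -> g \in Lfun mu 2%:E ->
  (\int[mu]_x (fine (ray h w g x) * f x)%:E =
   \int[mu]_x \int[L]_s (f x * g (x + s *: w)%R * chi s)%:E)%E.
Proof.
move=> fL gL; have iF := integrable_ray_prod w fL gL.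
have mf := Lfun2_measurable fL; have mg := Lfun2_measurable gL.
apply: ae_eq_integral => //.
- apply/measurable_EFinP; apply: measurable_funM => //.
  exact: (measurableT_comp (fine_measurable measurableT) (measurable_ray h w mg)).
- exact: (measurable_fubini_F iF).
have := ae_integrable1 iF; apply: filterS => x /= ix _.
(* Fubini gives integrability of [f x] times the slice of [g]. Dividing by [f x] makes the ray
   integral finite; where [f x = 0] it may be undefined, but both sides vanish. *)
have [f0|f0] := eqVneq (f x) 0.
  by rewrite f0 mulr0 integral0_eq// => s _; rewrite !mul0r.
have ig : L.-integrable setT (fun s => (g (x + s *: w) * chi s)%:E).
  have := integrableZl measurableT (f x)^-1 ix; apply: eq_integrable => // s _.
  by rewrite -EFinM -!mulrA mulKf.
rewrite mulrC EFinM fineK; last exact: (integrable_fin_num measurableT ig).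
rewrite /ray -integralZl//; apply: eq_integral => s _.
by rewrite -EFinM mulrA.
Qed.

(* Fubini and translation invariance move the averaging along a segment from one
   factor to the other, with the direction reversed. *)
Lemma ray_adjoint f g (w : 'rV[R]_n) : f \in Lfun mu 2%:E -> g \in Lfun mu 2%:E ->
  (\int[mu]_x (fine (ray h w g x) * f x)%:E =
   \int[mu]_x (g x * fine (ray h (- w) f x))%:E)%E.
Proof.
move=> fL gL; rewrite integral_ray_mul//.
under [RHS]eq_integral do rewrite mulrC.
rewrite integral_ray_mul//.
rewrite (Fubini (integrable_ray_prod w fL gL)) (Fubini (integrable_ray_prod (- w) gL fL)).
apply: eq_integral => s _ /=.
have iu : mu.-integrable setT (EFin \o (fun x => f x * g (x + s *: w) * chi s)).
  have := Lfun2_integrableM fL (Lfun2_shift (s *: w) gL).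
  move=> /(integrableZr measurableT (chi s)); apply: eq_integrable => // x _.
rewrite -(integral_shift (s *: - w) iu); apply: eq_integral => x _.
by rewrite -addrA -scalerDr addNr scaler0 addr0 (mulrC (g x)).
Qed.

End translation.

(** * Increments as averages of the weak derivative *)

Section difference_quotients.
Context {R : realType} {n : nat} (i : 'I_n) (h : R).
Hypothesis h_gt0 : 0 < h.
Local Notation mu := (lebesgue_rV n).
Local Notation L := (@lebesgue_measure R).
Local Notation e := (delta_mx ord0 i : 'rV[R]_n).
Local Notation chi := (\1_(`[0, h]%classic : set R)).
Implicit Types (x : 'rV[R]_n) (f u : 'rV[R]_n -> R) (phi : 'I_n -> R -> R).

Lemma locally_int_fine_ray f (w : 'rV[R]_n) : f \in Lfun mu 2%:E ->
  locally_int (fun x => fine (ray h w f x)).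
Proof.
move=> fL; have [mf foo] := (Lfun2P mu f).1 fL.
have mr : measurable_fun setT (fun x => fine (ray h w f x)).
  exact: (measurableT_comp (fine_measurable measurableT) (measurable_ray h w mf)).
have mf2 : measurable_fun setT (fun x => f x ^+ 2) by exact: measurable_funX.
have mr2 := measurable_ge0_ray h w mf2 (fun x => sqr_ge0 (f x)).
split=> // a b; apply/integrableP; split; first exact/measurable_EFinP/measurable_funTS.
have mB := measurable_obox a b.
have r0 x : (0 <= ray h w (fun x => f x ^+ 2)%R x)%E.
  by apply: integral_ge0 => s _; rewrite lee_fin mulr_ge0 ?sqr_ge0// chi_ge0.
apply: (@le_lt_trans _ _ (\int[mu]_(x in obox a b)
   ((2^-1 * 1 * h)%:E + (2 * 1)^-1%:E * ray h w (fun x => f x ^+ 2)%R x))%E).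
  apply: ge0_le_integral => //.
  - by apply: measurableT_comp => //; exact/measurable_EFinP/measurable_funTS.
  - by apply: emeasurable_funD => //; apply: measurable_funeM; exact: measurable_funTS.
  move=> x _ /=; apply: (le_trans (fine_ray_le h w x mf)).
  exact: ray_abs_le.
rewrite ge0_integralD//; last 3 first.
- by move=> x _; rewrite lee_fin !mulr_ge0// ltW.
- by move=> x _; rewrite mule_ge0// lee_fin invr_ge0.
- by apply: measurable_funeM; exact: measurable_funTS.
rewrite integral_cst// lte_add_pinfty//.
  by rewrite lte_mul_pinfty ?obox_lty// lee_fin !mulr_ge0// ltW.
rewrite ge0_integralZl//; last exact: measurable_funTS.
rewrite lte_mul_pinfty//.
apply: (@le_lt_trans _ _ (\int[mu]_x ray h w (fun x => f x ^+ 2)%R x)%E).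
  by apply: ge0_subset_integral => //.
rewrite integral_ray//; last by move=> x; exact: sqr_ge0.
by rewrite lte_mul_pinfty// lee_fin ltW.
Qed.

Lemma tensor_shift phi x (s : R) :
  tensor phi (x + s *: e) = tensor (set_factor i (fun y => phi i (y + s)) phi) x.
Proof.
rewrite -{1}(set_factor_id i phi) !tensor_set_factor !mxE !eqxx mulr1.
congr (_ * _); apply: eq_bigr => j ji.
by rewrite !mxE (negPf ji) andbF mulr0 addr0.
Qed.

Lemma integrable_locally_int_tensor f a b phi : locally_int f -> tensor_test a b phi ->
  mu.-integrable setT (fun x => (f x * tensor phi x)%:E).
Proof.
move=> [mf lf] tphi; have mB := measurable_obox a b.
have [M M0 phiM] := tensor_bounded tphi.
have iB : mu.-integrable (obox a b) ((EFin \o tensor phi) \* (EFin \o f))%E.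
  apply: integrableMr => //.
    exact: (measurable_funTS (measurable_tensor tphi)).
  exists M; split; first exact: num_real.
  by move=> y /ltW My x _; exact: le_trans (phiM x) My.
move: iB; rewrite (integrable_mkcond _ mB); apply: eq_integrable => // x _.
rewrite patchE; case: ifPn => [_|]; first by rewrite /= -EFinM mulrC.
by rewrite notin_setE => /(tensor_test_vanishes tphi) ->; rewrite mulr0.
Qed.

(** Tested against [phi], the ray average of the weak derivative moves to the test function and
    yields [Psi], where the factor [phi i] has become its own average [psi]. Since the partial
    derivative of [Psi] is [phi x - phi (x - h e)], the weak gradient identity and a translation
    give the increment of [u] tested against [phi]. *)
Lemma difference_eq_ray u g : u \in Lfun mu 2%:E -> L2_weak_grad u g ->
  {ae mu, forall x, u (x + h *: e) - u x = fine (ray h e (fun y => g y ord0 i) x)}.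
Proof.
move=> uL [/(_ i) gL ug]; pose gi x := g x ord0 i.
pose D x := u (x + h *: e) - u x - fine (ray h e gi x).
suff : {ae mu, forall x, D x = 0}.
  by apply: filterS => x /eqP; rewrite subr_eq0 => /eqP.
have usL := Lfun2_shift (h *: e) uL.
have LG := locally_int_fine_ray e gL.
apply: ae_eq0_tensor.
  apply: locally_intB => //; apply: locally_intB; exact: Lfun2_locally_int.
move=> a b phi tphi; have phiL := Lfun2_tensor tphi.
have [sphi vphi] := tphi i.
have [psi [spsi vpsi dpsi ipsi]] := smooth_shift_primitive h_gt0 sphi vphi.
pose Psi := set_factor i psi phi.
have tPsi : tensor_test a (b + h *: e) Psi.
  move=> j; rewrite /Psi /set_factor !mxE eqxx; case: eqVneq => [->|ji].
    by rewrite mulr1.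
  by rewrite mulr0 addr0; exact: tphi.
have tensPsi x : fine (ray h (- e) (tensor phi) x) = tensor Psi x.
  rewrite /ray; under eq_integral do rewrite scalerN -scaleNr tensor_shift tensor_set_factor.
  rewrite tensor_set_factor.
  set C := \prod_(_ | _) _.
  transitivity (fine (\int[L]_(s in `[0%R, h]) (C%:E * (phi i (x ord0 i - s))%:E))%E).
    congr fine; rewrite [RHS]integral_mkcond; apply: eq_integral => s _.
    rewrite patchE indicE; case: (_ \in _); last by rewrite mulr0.
    by rewrite mulr1 -EFinM mulrC.
  rewrite integralZl//; first by rewrite ipsi/= mulrC.
  apply: continuous_compact_integrable; first exact: segment_compact.
  apply: continuous_subspaceT.
  have -> : (fun s => phi i (x ord0 i - s)) = (fun s => phi i (-1 * s + x ord0 i)).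
    by apply/funext => s; rewrite mulN1r addrC.
  exact: (smooth1_comp_affine (k := 0) _ _ (smooth_continuous sphi)).
have d1 x : tensor (set_factor i (derive1 (Psi i)) Psi) x = tensor phi x - tensor phi (x - h *: e).
  have -> : tensor phi x = phi i (x ord0 i) * \prod_(j | j != i) phi j (x ord0 j).
    by rewrite -{1}(set_factor_id i phi) tensor_set_factor.
  rewrite -scaleNr tensor_shift !tensor_set_factor -mulrBl.
  rewrite {1}/Psi {1}/set_factor eqxx dpsi; congr (_ * _).
  by apply: eq_bigr => j /negPf ji; rewrite /Psi /set_factor ji.
have shL := Lfun2_shift (- (h *: e)) phiL.
have iGphi : mu.-integrable setT (fun x => (fine (ray h e gi x) * tensor phi x)%:E).
  exact: integrable_locally_int_tensor tphi.
rewrite /D; under eq_integral do rewrite mulrBl mulrBl EFinB EFinB.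
rewrite integralB//; last first.
  by apply: integrableB => //; exact: Lfun2_integrableM.
rewrite integralB//; try exact: Lfun2_integrableM.
rewrite ray_adjoint//; under [X in (_ - X)%E]eq_integral do rewrite tensPsi.
have -> : (\int[mu]_x (gi x * tensor Psi x)%:E =
   - \int[mu]_x (u x * (tensor phi x - tensor phi (x - h *: e)))%:E)%E.
  have := weak_grad_tensor i ug tPsi => /eqP.
  rewrite -eqe_oppLR => /eqP <-.
  by congr (- _)%E; apply: eq_integral => x _; rewrite d1.
have -> : (\int[mu]_x (u (x + h *: e)%R * tensor phi x)%:E =
    \int[mu]_x (u x * tensor phi (x - h *: e))%:E)%E.
  have iu := Lfun2_integrableM uL shL.
  rewrite -(integral_shift (h *: e) iu); apply: eq_integral => x _.
  by rewrite addrK.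
under [X in (_ - - X)%E]eq_integral do rewrite mulrBr EFinB.
rewrite [X in (_ - - X)%E]integralB//; try exact: Lfun2_integrableM.
have /(integrable_fin_num measurableT) := Lfun2_integrableM uL shL.
have /(integrable_fin_num measurableT) := Lfun2_integrableM uL phiL.
rewrite /=; case: (\int[mu]_x (u x * tensor phi x)%:E)%E => // p _.
case: (\int[mu]_x _)%E => // q _.
rewrite (_ : (q%:E - p%:E - - (p%:E - q%:E))%E = (q - p - - (p - q))%:E)//.
by congr EFin; ring.
Qed.

Lemma measurable_superlevel f (t : R) : measurable_fun setT f ->
  measurable [set x | t < f x].
Proof.
move=> mf; rewrite (_ : [set x | _] = f @^-1` `]t, +oo[%classic).
  by rewrite -[X in measurable X]setTI; exact: mf.
by apply/seteqP; split => x /=; rewrite in_itv/= andbT.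
Qed.

(* Averaging [`|g| <= c / 2 + g ^ 2 / (2 c)] with [c = t / h] over the segment from
   [x] to [x + h e]: if the increment of [u] exceeds [t], then the integral of
   [g ^ 2] over that segment exceeds [t ^ 2 / h]. *)
Lemma difference_superlevel_le u g (t : R) : u \in Lfun mu 2%:E -> L2_weak_grad u g -> 0 < t ->
  (mu [set x | (t < `|u (x + h *: e) - u x|)%R] <=
   (h ^+ 2 / t ^+ 2)%:E * sqint mu (fun x => g x ord0 i))%E.
Proof.
move=> uL ug t0; have [/(_ i) gL _] := ug; set gi := fun x => g x ord0 i.
have mgi : measurable_fun setT gi := Lfun2_measurable gL.
have mgi2 : measurable_fun setT (fun x => gi x ^+ 2) by exact: measurable_funX.
have mu_ := Lfun2_measurable uL; have mus := Lfun2_measurable (Lfun2_shift (h *: e) uL).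
set A := [set x | _].
have mA : measurable A.
  apply: (measurable_superlevel (f := fun x => `|u (x + h *: e) - u x|)).
  by apply: measurableT_comp => //; exact: measurable_funB.
have msq := measurable_ge0_ray h e mgi2 (fun x => sqr_ge0 (gi x)).
have sq0 x : (0 <= ray h e (fun x => gi x ^+ 2)%R x)%E.
  by apply: integral_ge0 => s _; rewrite lee_fin mulr_ge0 ?sqr_ge0// chi_ge0.
have ht0 : 0 <= h / t ^+ 2 by rewrite divr_ge0 ?sqr_ge0// ltW.
have -> : mu A = (\int[mu]_x (\1_A x)%:E)%E by rewrite integral_indic// setIT.
apply: (@le_trans _ _ (\int[mu]_x ((h / t ^+ 2)%:E * ray h e (fun x => gi x ^+ 2)%R x))%E).
  apply: ae_ge0_le_integral => //.
  - by apply/measurable_EFinP; exact: measurable_indic.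
  - by move=> x _; rewrite mule_ge0// lee_fin.
  - exact: measurable_funeM.
  have := difference_eq_ray uL ug; apply: filterS => x dux _.
  rewrite indicE; case: (boolP (x \in A)) => [|_]; last by rewrite mule_ge0.
  rewrite inE => tux.
  have c0 : 0 < t / h by rewrite divr_gt0.
  have := le_trans (fine_ray_le h e x mgi) (ray_abs_le e h_gt0 x mgi c0).
  rewrite -dux.
  (* If the average of [gi ^+ 2] is infinite, the bound is [+oo] because its coefficient is
     positive. *)
  case: (ray h e (fun x => gi x ^+ 2)%R x) (sq0 x) => [r r0| |//]; last first.
    by move=> _ _; rewrite gt0_muley ?leey// lte_fin divr_gt0 ?exprn_gt0.
  rewrite -EFinM -EFinD lee_fin -EFinM lee_fin => H.
  have e1 : 2^-1 * (t / h) * h = t / 2 by field; rewrite gt_eqF.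
  have e2 : (2 * (t / h))^-1 * r = h * r / (2 * t) by field; rewrite !gt_eqF.
  have {H} := lt_le_trans tux H; rewrite e1 e2 => H.
  have : t - t / 2 < h * r / (2 * t) by rewrite ltrBlDl.
  rewrite ltr_pdivlMr ?mulr_gt0// => K.
  rewrite mulrAC ler_pdivlMr ?exprn_gt0// mul1r.
  by apply: le_trans (ltW K); rewrite (_ : (t - t / 2) * (2 * t) = t ^+ 2)//; field.
rewrite ge0_integralZl// integral_ray//; last by move=> x; exact: sqr_ge0.
by rewrite muleA -EFinM expr2 mulrAC.
Qed.

End difference_quotients.

(** * Subcritical Sobolev embedding *)

Section level_sets.
Context {R : realType} {n : nat}.
Local Notation mu := (lebesgue_rV n).
Local Notation e i := (delta_mx ord0 i : 'rV[R]_n).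
Implicit Types (x y : 'rV[R]_n) (u : 'rV[R]_n -> R) (g : 'rV[R]_n -> 'rV[R]_n).

Definition sqgrad g : \bar R := (\sum_i sqint mu (fun x => g x ord0 i))%E.

Lemma measurable_difference_superlevel u y (t : R) : measurable_fun setT u ->
  measurable [set x | t < `|u (x + y) - u x|].
Proof.
move=> mu_; apply: (measurable_superlevel (f := fun x => `|u (x + y) - u x|)).
apply: measurableT_comp => //; apply: measurable_funB => //.
exact: (measurableT_comp mu_ (measurable_shift y)).
Qed.

(** The translation is made one coordinate at a time: if the total increment exceeds [size r] times
    [s], some single increment exceeds [s]. The newest increment starts at the shifted point
    [x + Y], which does not change the measure of its superlevel set. *)
Lemma sum_difference_superlevel_le u g y (l s : R) (r : seq 'I_n) :
  u \in Lfun mu 2%:E -> L2_weak_grad u g -> (forall i, 0 < y ord0 i < l) -> 0 < s ->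
  (mu [set x | ((size r)%:R * s < `|u (x + \sum_(i <- r) y ord0 i *: e i) - u x|)%R] <=
   (l ^+ 2 / s ^+ 2)%:E * \sum_(i <- r) sqint mu (fun x => g x ord0 i))%E.
Proof.
move=> uL ug yl s0; have mu_ := Lfun2_measurable uL.
elim: r => [|i r IH].
  rewrite !big_nil mule0 (_ : [set x | _] = set0) ?measure0//.
  by apply/seteqP; split => // x /=; rewrite addr0 subrr normr0 mul0r ltxx.
rewrite !big_cons ge0_muleDr ?sqint_ge0//; last by apply: sume_ge0 => j _; exact: sqint_ge0.
set Y := \sum_(j <- r) _ in IH *.
pose B := [set x | s < `|u (x + y ord0 i *: e i) - u x|].
have mB : measurable B by exact: measurable_difference_superlevel.
apply: (@le_trans _ _ (mu ([set x | B (x + Y)] `|`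
    [set x | (size r)%:R * s < `|u (x + Y) - u x|]))).
  apply: le_measure; rewrite ?inE; try exact: measurable_difference_superlevel.
    apply: measurableU; last exact: measurable_difference_superlevel.
    by rewrite -[X in measurable X]setTI; exact: measurable_shift.
  move=> x /=; rewrite -/Y /B /= => H.
  rewrite -addrA (addrC Y); apply/orP; rewrite -implyNb; apply/implyP; rewrite -leNgt => H1.
  rewrite ltNge; apply/negP => H2; move: H; rewrite ltNge => /negP; apply.
  rewrite -(addn1 (size r)) natrD mulrDl mul1r [leRHS]addrC.
  apply: le_trans (lerD H1 H2); rewrite -(subrKA (u (x + Y))); exact: ler_normD.
apply: (le_trans (measureU2 _ _ _)) => //.
- by rewrite -[X in measurable X]setTI; exact: measurable_shift.
- exact: measurable_difference_superlevel.
apply: leeD => //; apply: (@le_trans _ _ (mu B)).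
  by rewrite le_eqVlt; apply/orP; left; apply/eqP; exact: lebesgue_shift.
have /andP[yi0 yil] := yl i.
have dle := difference_superlevel_le i yi0 uL ug s0.
apply: (le_trans dle).
apply: lee_wpmul2r; first exact: sqint_ge0.
rewrite lee_fin ler_pM2r ?invr_gt0 ?exprn_gt0//.
by rewrite lerXn2r ?nnegrE ?ltW// (lt_trans yi0).
Qed.

Lemma translate_superlevel_le u g y (l t : R) : (0 < n)%N ->
  u \in Lfun mu 2%:E -> L2_weak_grad u g -> (forall i, 0 < y ord0 i < l) -> 0 < t ->
  (mu [set x | (t < `|u (x + y) - u x|)%R] <= (n%:R ^+ 2 * l ^+ 2 / t ^+ 2)%:E * sqgrad g)%E.
Proof.
move=> n0 uL ug yl t0; have n0' : (0 : R) < n%:R by rewrite ltr0n.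
(* Each of the [n] coordinate moves is allotted [t / n], which produces the factor [n ^ 2]. *)
have s0 : 0 < t / n%:R by rewrite divr_gt0.
have := sum_difference_superlevel_le (index_enum 'I_n) uL ug yl s0.
rewrite -row_sum_delta (_ : size _ = n); last by rewrite /index_enum -enumT size_enum_ord.
rewrite mulrC divfK ?gt_eqF// (_ : l ^+ 2 / (t / n%:R) ^+ 2 = n%:R ^+ 2 * l ^+ 2 / t ^+ 2)//.
by field; rewrite !gt_eqF.
Qed.

Lemma chebyshev2 u (t : R) : measurable_fun setT u -> 0 < t ->
  ((t ^+ 2)%:E * mu [set x | (t < `|u x|)%R] <= sqint mu u)%E.
Proof.
move=> mu_ t0; have mA : measurable [set x | t < `|u x|].
  by apply: measurable_superlevel; exact: measurableT_comp.
rewrite -[X in mu X]setIT -integral_indic// -ge0_integralZl//; last 2 first.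
- by apply/measurable_EFinP; exact: measurable_indic.
- by rewrite lee_fin sqr_ge0.
apply: ge0_le_integral => //.
- by move=> x _; rewrite mule_ge0// lee_fin sqr_ge0.
- by apply: measurable_funeM; apply/measurable_EFinP; exact: measurable_indic.
- by apply/measurable_EFinP; exact: measurable_funX.
move=> x _; rewrite indicE -EFinM lee_fin.
case: (boolP (x \in _)); last by rewrite mulr0 sqr_ge0.
rewrite inE/= mulr1 -[leRHS]real_normK ?num_real// => /ltW.
by apply: lerXn2r; rewrite nnegrE// ltW.
Qed.

(** Real-valued so that fractional powers can be taken. For [0 < t] and [u] in L^2 nothing is lost,
    by Chebyshev; for [t <= 0] the measure may be infinite, and [fine] then returns 0. *)
Definition level u (t : R) : R := fine (mu [set x | t < `|u x|]).

Lemma level_ge0 u t : 0 <= level u t.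
Proof. exact: fine_ge0. Qed.

Lemma levelE u t : u \in Lfun mu 2%:E -> 0 < t ->
  mu [set x | t < `|u x|] = (level u t)%:E.
Proof.
move=> /Lfun2P[mu_ uoo] t0; rewrite /level fineK// ge0_fin_numE//.
have := le_lt_trans (chebyshev2 mu_ t0) uoo.
case: (mu _) (measure_ge0 mu [set x | t < `|u x|]) => // [r _ _|_]; first exact: ltry.
by rewrite gt0_muley ?lte_fin ?exprn_gt0.
Qed.

(** Tonelli for 1_A(x) 1_B(x + y): for each [x] the integral over [y] is [mu B]. It measures how
    much of [A] the translations carry into [B]. *)
Lemma integral_measure_setI_shift (A B : set 'rV[R]_n) : measurable A -> measurable B ->
  measurable_fun setT (fun y => mu (A `&` [set x | B (x + y)])) /\
  (\int[mu]_y mu (A `&` [set x | B (x + y)%R]) = mu A * mu B)%E.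
Proof.
move=> mA mB.
pose F (z : 'rV[R]_n * 'rV[R]_n) : \bar R := (\1_A z.2 * \1_B (z.2 + z.1))%:E.
have mF : measurable_fun setT F.
  apply/measurable_EFinP; apply: measurable_funM.
    exact: (measurableT_comp (measurable_indic mA) measurable_snd).
  have madd : measurable_fun setT (fun z : 'rV[R]_n * 'rV[R]_n => z.2 + z.1).
    apply: measurable_fun_rV => j; under eq_fun do rewrite !mxE.
    apply: measurable_funD.
      exact: (measurableT_comp (measurable_coord j) measurable_snd).
    exact: (measurableT_comp (measurable_coord j) measurable_fst).
  exact: (measurableT_comp (measurable_indic mB) madd).
have F0 z : (0 <= F z)%E by rewrite lee_fin mulr_ge0.
have mBy y : measurable [set x | B (x + y)].
  by rewrite -[X in measurable X]setTI; exact: measurable_shift.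
have FE y : (\int[mu]_x F (y, x) = mu (A `&` [set x | B (x + y)%R]))%E.
  rewrite -[X in _ = mu X]setIT -integral_indic//; last exact: measurableI.
  apply: eq_integral => x _; rewrite /F/= !indicE in_setI.
  by case: (_ \in A); rewrite ?mul1r ?mul0r.
split.
  rewrite (_ : (fun y => _) = fubini_F mu F); last by apply/funext => y; rewrite /fubini_F FE.
  exact: measurable_fun_fubini_tonelli_F.
under eq_integral do rewrite -FE.
rewrite (fubini_tonelli (m1 := mu) (m2 := mu) F)//.
transitivity (\int[mu]_x ((\1_A x)%:E * mu B))%E.
  apply: eq_integral => x _; rewrite /F/=; under eq_integral do rewrite EFinM.
  rewrite ge0_integralZl//; last first.
    apply/measurable_EFinP; under eq_fun do rewrite addrC.
    exact: (measurableT_comp (measurable_indic mB) (measurable_shift x)).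
  congr (_ * _)%E; under eq_integral do rewrite addrC.
  rewrite (ge0_integral_shift x (f := fun y => (\1_B y)%:E))//; last first.
    by apply/measurable_EFinP; exact: measurable_indic.
  by rewrite integral_indic// setIT.
rewrite ge0_integralZr//; last by apply/measurable_EFinP; exact: measurable_indic.
by rewrite integral_indic// setIT.
Qed.

End level_sets.

(** * The doubling inequality for level sets *)

Section level_decay.
Context {R : realType} {n : nat}.
Hypothesis n_gt0 : (0 < n)%N.
Local Notation mu := (lebesgue_rV n).
Implicit Types (x y : 'rV[R]_n) (u : 'rV[R]_n -> R) (g : 'rV[R]_n -> 'rV[R]_n).

Lemma level_nonincreasing u s t : u \in Lfun mu 2%:E -> 0 < s -> s <= t ->
  level u t <= level u s.
Proof.
move=> uL s0 st; have mu_ := Lfun2_measurable uL.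
have mA (r : R) : measurable [set x | r < `|u x|].
  by apply: measurable_superlevel; exact: measurableT_comp.
rewrite -lee_fin -!levelE//; last exact: lt_le_trans st.
by apply: le_measure; rewrite ?inE// => x /=; exact: le_lt_trans.
Qed.

Lemma sqgrad_fin g : (forall i, (fun x => g x ord0 i) \in Lfun mu 2%:E) ->
  sqgrad g \is a fin_num.
Proof.
move=> gL; rewrite /sqgrad; elim/big_ind: _ => // [p q pf qf|i _]; first by rewrite fin_numD pf qf.
by rewrite ge0_fin_numE ?sqint_ge0//; have /Lfun2P[] := gL i.
Qed.

(* If [2 t < |u x|], then for every [y] either [t < |u (x + y)|] or the increment
   [u (x + y) - u x] exceeds [t] in absolute value. The inequality follows by
   integrating over [y] in the cube [(0, l)^n]. *)
Lemma level_double_le u g (l t : R) : u \in Lfun mu 2%:E -> L2_weak_grad u g -> 0 < t -> 0 < l ->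
  level u (2 * t) * l ^+ n <= level u (2 * t) * level u t +
    n%:R ^+ 2 * l ^+ 2 / t ^+ 2 * fine (sqgrad g) * l ^+ n.
Proof.
move=> uL ug t0 l0; have mu_ := Lfun2_measurable uL.
have gfin := sqgrad_fin ug.1.
set c := _ * fine (sqgrad g).
have c0 : 0 <= c.
  apply: mulr_ge0; first by rewrite divr_ge0 ?sqr_ge0// mulr_ge0 ?sqr_ge0.
  by rewrite fine_ge0// sume_ge0// => i _; exact: sqint_ge0.
pose A (r : R) := [set x | r < `|u x|].
have mA r : measurable (A r) by apply: measurable_superlevel; exact: measurableT_comp.
pose Y : set 'rV[R]_n := obox 0 (const_mx l).
have mY : measurable Y by exact: measurable_obox.
have muY : mu Y = (l ^+ n)%:E.
  rewrite lebesgue_oboxE; congr EFin.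
  under eq_bigr do rewrite !mxE subr0 max_r ?ltW//.
  by rewrite prodr_const card_ord.
have t20 : 0 < 2 * t by rewrite mulr_gt0.
have [mI IE] := integral_measure_setI_shift (mA (2 * t)) (mA t).
have key y : Y y -> (mu (A (2 * t)%R) <= mu (A (2 * t)%R `&` [set x | A t (x + y)%R]) + c%:E)%E.
  move=> Yy.
  have yl i : 0 < y ord0 i < l by have := Yy i; rewrite /= in_itv/= !mxE.
  have mS : measurable [set x | A t (x + y)].
    by rewrite -[X in measurable X]setTI; exact: measurable_shift.
  have mD := measurable_difference_superlevel y t mu_.
  apply: (@le_trans _ _ (mu ((A (2 * t) `&` [set x | A t (x + y)]) `|`
     [set x | t < `|u (x + y) - u x|]))).
    apply: le_measure; rewrite ?inE//; first by apply: measurableU => //; exact: measurableI.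
    move=> x; rewrite /A /= => ux; have [h|h] := ltP t `|u (x + y)|; [by left|right].
    have : `|u x| <= `|u (x + y) - u x| + `|u (x + y)|.
      rewrite -[u x in leLHS](subKr (u (x + y))) distrC.
      by rewrite (le_trans (ler_normD _ _))// normrN addrC distrC.
    lra.
  apply: (le_trans (measureU2 _ _ _)) => //; first exact: measurableI.
  apply: leeD => //; rewrite /c EFinM fineK//.
  exact: translate_superlevel_le.
have : (\int[mu]_(y in Y) cst (mu (A (2 * t)%R)) y <=
    \int[mu]_(y in Y) (mu (A (2 * t)%R `&` [set x | A t (x + y)%R]) + c%:E))%E.
  apply: ge0_le_integral => //.
  by apply: emeasurable_funD => //; exact: measurable_funTS.
have intY (r : \bar R) : (\int[mu]_(y in Y) cst r y = r * (l ^+ n)%:E)%E.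
  by rewrite integral_cst//; congr (_ * _)%E; exact: muY.
rewrite intY ge0_integralD//; last exact: measurable_funTS.
rewrite intY.
(* Enlarging the cube to the whole space turns the overlap integral into a product of measures. *)
have : (\int[mu]_(y in Y) mu (A (2 * t)%R `&` [set x | A t (x + y)%R]) <=
    mu (A (2 * t)%R) * mu (A t))%E.
  by rewrite -IE; exact: ge0_subset_integral.
rewrite {2 3}/A !levelE// => h1 h2; rewrite -lee_fin; apply: (le_trans h2).
by rewrite EFinD !EFinM leeD2r.
Qed.

(* The edge [l] of the cube is chosen so that its volume [l ^ n] is twice the
   measure of the level set [t < |u|]. *)
Lemma level_doubling u g : u \in Lfun mu 2%:E -> L2_weak_grad u g ->
  exists2 K, 0 <= K & forall t, 0 < t ->
    level u (2 * t) <= K / t ^+ 2 * level u t `^ (2 / n%:R).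
Proof.
move=> uL ug; pose G := fine (sqgrad g).
have G0 : 0 <= G by rewrite fine_ge0// sume_ge0// => i _; exact: sqint_ge0.
have K0 : 0 <= 2 * n%:R ^+ 2 * G * 2 `^ (2 / n%:R).
  by rewrite !mulr_ge0 ?powR_ge0// sqr_ge0.
exists (2 * n%:R ^+ 2 * G * 2 `^ (2 / n%:R)) => // t t0.
(* An empty level would force edge 0; this case follows from monotonicity instead. *)
have [a0|a0] := eqVneq (level u t) 0.
  apply: (@le_trans _ _ 0); last by apply: mulr_ge0; rewrite ?powR_ge0// divr_ge0 ?sqr_ge0.
  have t2 : t <= 2 * t by lra.
  by have := level_nonincreasing uL t0 t2; rewrite a0.
have a1 : 0 < level u t by rewrite lt_neqAle eq_sym a0 level_ge0.
pose l := (2 * level u t) `^ (n%:R^-1).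
have l0 : 0 < l by rewrite powR_gt0// mulr_gt0.
have n0 : n%:R != 0 :> R by rewrite pnatr_eq0 -lt0n.
have ln : l ^+ n = 2 * level u t.
  by rewrite -powR_mulrn ?ltW// -powRrM mulVf// powRr1// mulr_ge0// level_ge0.
have l2 : l ^+ 2 = 2 `^ (2 / n%:R) * level u t `^ (2 / n%:R).
  by rewrite -powR_mulrn ?ltW// -powRrM -powRM ?level_ge0// (mulrC n%:R^-1).
have := level_double_le uL ug t0 l0.
rewrite ln -/G l2; set p := 2 `^ _; set q := _ `^ _.
set a := level u t in a1 *; set b := level u _.
(* The inequality now reads [b * (2 * a) <= b * a + c * a]: the overlap absorbs only half of the
   left side, and dividing by [a] leaves [b <= c]. *)
have -> : n%:R ^+ 2 * (p * q) / t ^+ 2 * G * (2 * a) =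
  (2 * n%:R ^+ 2 * G * p / t ^+ 2 * q) * a by ring.
set c := _ * q => H.
rewrite -(ler_pM2r a1); lra.
Qed.

End level_decay.

(** * From decay of level sets to integrability of powers *)

Section embedding.
Context {R : realType} {n : nat}.
Hypothesis n_ge2 : (2 <= n)%N.
Local Notation mu := (lebesgue_rV n).
Implicit Types (x y : 'rV[R]_n) (u : 'rV[R]_n -> R) (g : 'rV[R]_n -> 'rV[R]_n).

Definition dyadic_decay u (al : R) : Prop :=
  exists2 M : R, 0 <= M & forall k, level u (2 ^+ k) <= M * 2 `^ (- (k%:R * al)).

(* The doubling inequality turns the exponent [al] into [2 + 2 al / n], a gain of
   [2 - (1 - 2 / n) al], which stays bounded below while [al <= q]. *)
Lemma dyadic_decay_step u g (al q : R) : u \in Lfun mu 2%:E -> L2_weak_grad u g ->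
  al <= q -> dyadic_decay u al -> dyadic_decay u (al + (2 - (1 - 2 / n%:R) * q)).
Proof.
move=> uL ug alq [M M0 hM].
have n0 : (0 < n)%N by exact: leq_trans n_ge2.
have [K K0 hK] := level_doubling n0 uL ug.
have n0' : (0 : R) < n%:R by rewrite ltr0n.
have n2 : 2 / n%:R <= 1 :> R by rewrite ler_pdivrMr// mul1r ler_nat.
set d := 2 - _; set al' := al + d.
have al'_le : al' <= 2 + 2 / n%:R * al.
  have : 0 <= (1 - 2 / n%:R) * (q - al) by rewrite mulr_ge0 ?subr_ge0.
  rewrite /al' /d; set m := 2 / n%:R; lra.
(* The first summand covers [k = 0]. The second covers [k.+1], where the doubling inequality is used
   at level [2 ^+ k] and the factor 2 ^ al' pays for the index shift. *)
pose M' := level u 1 + K * M `^ (2 / n%:R) * 2 `^ al'.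
have c0 : 0 <= K * M `^ (2 / n%:R) * 2 `^ al' by rewrite !mulr_ge0 ?powR_ge0.
exists M'; first by rewrite addr_ge0 ?level_ge0.
case=> [|k].
  by rewrite expr0 mul0r oppr0 powRr0 mulr1 /M' lerDl.
have p2k : (0 : R) < 2 ^+ k by rewrite exprn_gt0.
rewrite exprS; apply: (le_trans (hK _ p2k)).
apply: (@le_trans _ _ (K * M `^ (2 / n%:R) * 2 `^ (- (k%:R * al')))).
  rewrite -!mulrA ler_wpM2l//.
  have le1 : level u (2 ^+ k) `^ (2 / n%:R) <= M `^ (2 / n%:R) * 2 `^ (- (k%:R * al) * (2 / n%:R)).
    rewrite (powRrM 2 (- (k%:R * al))) -powRM ?powR_ge0//.
    have n2' : 0 <= 2 / n%:R :> R by rewrite divr_ge0// ltW.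
    by apply: (ge0_ler_powR n2') (hM k); rewrite nnegrE ?level_ge0// mulr_ge0 ?powR_ge0.
  have -> : ((2 : R) ^+ k ^+ 2)^-1 = 2 `^ (- (k%:R * 2)).
    by rewrite powRN powRrM !powR_mulrn// exprn_ge0.
  apply: (le_trans (ler_wpM2l _ le1)); first exact: powR_ge0.
  rewrite mulrCA ler_wpM2l ?powR_ge0// -powRD; last by apply/implyP.
  apply: ler_powR; first by rewrite ler1n.
  rewrite mulNr -opprD lerN2 -mulrA -mulrDr ler_wpM2l//.
  by rewrite (mulrC al).
apply: (@le_trans _ _ (K * M `^ (2 / n%:R) * 2 `^ al' * 2 `^ (- (k.+1%:R * al')))).
  rewrite -[leRHS]mulrA -powRD; last by apply/implyP.
  by rewrite (_ : al' + - (k.+1%:R * al') = - (k%:R * al'))// -natr1; ring.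
by rewrite ler_wpM2r ?powR_ge0// /M' lerDr level_ge0.
Qed.

(** The start is exponent 0, by monotonicity of the levels. A step gains the fixed amount [d > 0]
    but is valid only up to [q], hence the disjunction in the induction; more than [q / d] steps
    suffice. *)
Lemma dyadic_decay_gt u g (q : R) : u \in Lfun mu 2%:E -> L2_weak_grad u g ->
  (1 - 2 / n%:R) * q < 2 -> exists2 al, q < al & dyadic_decay u al.
Proof.
move=> uL ug dq; set d := 2 - (1 - 2 / n%:R) * q.
have d0 : 0 < d by rewrite subr_gt0.
have H j : (exists2 al, q < al & dyadic_decay u al) \/ dyadic_decay u (j%:R * d).
  elim: j => [|j [IH|IH]]; [right|by left|].
    exists (level u 1); first exact: level_ge0.
    move=> k; rewrite mul0r mulr0 oppr0 powRr0 mulr1.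
    by apply: level_nonincreasing => //; rewrite exprn_ege1// ler1n.
  have [jq|jq] := leP (j%:R * d) q; last by left; exists (j%:R * d).
  right; have := dyadic_decay_step uL ug jq IH.
  by rewrite -/d -natr1 mulrDl mul1r.
have [//|Hj] := H (Num.truncn (q / d)).+1.
exists ((Num.truncn (q / d)).+1%:R * d) => //.
by rewrite -ltr_pdivrMr// truncnS_gt.
Qed.

(** For [r <= 1] the square dominates since [2 <= q]. For [r > 1], choose m with 2^m < r <= 2^(m+1):
    the single term k = m is already at least r^q. *)
Lemma powR_le_dyadic (q r : R) : 2 <= q -> 0 <= r ->
  ((r `^ q)%:E <= (r ^+ 2)%:E + \sum_(0 <= k <oo) (2 `^ (k.+1%:R * q) * (2 ^+ k < r)%R%:R)%:E)%E.
Proof.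
move=> q2 r0.
have F0 k : (0%:E <= ((2 : R) `^ (k.+1%:R * q) * (2 ^+ k < r)%R%:R)%:E)%E.
  by rewrite lee_fin mulr_ge0 ?powR_ge0.
have [r1|r1] := leP r 1.
  apply: (@le_trans _ _ (r ^+ 2)%:E).
    rewrite lee_fin -powR_mulrn//.
    have [->|rn0] := eqVneq r 0; first by rewrite !powR0// gt_eqF// (lt_le_trans _ q2).
    by apply: ger_powR => //; rewrite r1 andbT lt_neqAle eq_sym rn0.
  by rewrite leeDl// nneseries_ge0.
have ex : exists m, r <= 2 ^+ m.
  exists (Num.truncn r).+1; apply: ltW; apply: (lt_trans (truncnS_gt r)).
  by rewrite -natrX ltr_nat ltn_expl.
case: (ex_minnP ex) => -[|m] rm hm; first by move: rm; rewrite expr0 leNgt r1.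
have m1 : 2 ^+ m < r by rewrite ltNge; apply/negP => /hm; rewrite ltnn.
apply: (@le_trans _ _ (\sum_(0 <= k < m.+1) (2 `^ (k.+1%:R * q) * (2 ^+ k < r)%R%:R)%:E)%E).
  rewrite big_nat_recr//=; apply: (@le_trans _ _ (2 `^ (m.+1%:R * q) * (2 ^+ m < r)%R%:R)%:E).
    rewrite m1 mulr1 lee_fin powRrM powR_mulrn//.
    apply: ge0_ler_powR => //; rewrite ?nnegrE ?exprn_ge0//; lra.
  by rewrite leeDr// sume_ge0.
apply: (le_trans (nneseries_lim_ge _ _)) => //.
by rewrite leeDr// lee_fin sqr_ge0.
Qed.

Lemma nneseries_geometric_lty (c r : R) : 0 <= c -> 0 < r < 1 ->
  (\sum_(0 <= k <oo) (c * r ^+ k)%:E < +oo)%E.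
Proof.
move=> c0 /andP[r0 r1].
apply: (@le_lt_trans _ _ (c / (1 - r))%:E); last exact: ltry.
apply: lime_le.
  by apply: is_cvg_nneseries => k _ _; rewrite lee_fin mulr_ge0// exprn_ge0// ltW.
apply: nearW => N; rewrite sumEFin lee_fin.
by apply: (geometric_le_lim N) => //; rewrite gtr0_norm.
Qed.

(** Integrating the dyadic bound leaves the square integral of [u] plus the series of 2^((k+1) q)
    [level u (2 ^+ k)]. Decay of order [al > q] dominates it by a geometric series of ratio 2^(q -
    al). *)
Theorem subcritical_embedding u (q : R) : sobolev_H1 u -> 2 <= q ->
  (1 - 2 / n%:R) * q < 2 -> (\int[mu]_x (`|u x| `^ q)%:E < +oo)%E.
Proof.
move=> [uL [g ug]] q2 qn.
have [mu_ uoo] := (Lfun2P mu u).1 uL.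
have [al qal [M M0 hM]] := dyadic_decay_gt uL ug qn.
pose F k x : \bar R := (2 `^ (k.+1%:R * q) * (2 ^+ k < `|u x|)%R%:R)%:E.
have F0 k x : (0 <= F k x)%E by rewrite lee_fin mulr_ge0 ?powR_ge0.
have mA (r : R) : measurable [set x | r < `|u x|].
  by apply: measurable_superlevel; exact: measurableT_comp.
have FE k : F k = (fun x => (2 `^ (k.+1%:R * q))%:E * (\1_[set x | 2 ^+ k < `|u x|] x)%:E)%E.
  apply/funext => x; rewrite /F EFinM indicE.
  suff -> : (x \in [set x | 2 ^+ k < `|u x|]) = (2 ^+ k < `|u x|) by [].
  by apply/idP/idP; rewrite inE.
have mF k : measurable_fun setT (F k).
  rewrite FE; apply: measurable_funeM.
  by apply/measurable_EFinP; exact: measurable_indic.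
have m2 : measurable_fun setT (fun x => (u x ^+ 2)%:E).
  by apply/measurable_EFinP; exact: measurable_funX.
have mS : measurable_fun setT (fun x => \sum_(0 <= k <oo) F k x)%E.
  exact: ge0_emeasurable_sum.
apply: (@le_lt_trans _ _ (\int[mu]_x ((u x ^+ 2)%:E + \sum_(0 <= k <oo) F k x))%E).
  apply: ge0_le_integral => //.
  - apply/measurable_EFinP.
    by apply: (measurableT_comp (measurable_powR q)); exact: measurableT_comp.
  - exact: emeasurable_funD.
  move=> x _; rewrite -[u x ^+ 2]real_normK ?num_real//.
  exact: powR_le_dyadic.
rewrite ge0_integralD//; last 2 first.
- by move=> x _; rewrite lee_fin sqr_ge0.
- by move=> x _; exact: nneseries_ge0.
rewrite lte_add_pinfty// integral_nneseries//.
pose r : R := 2 `^ (q - al).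
have r01 : 0 < r < 1.
  rewrite powR_gt0//= /r /powR pnatr_eq0/= -[ltRHS]expR0 ltr_expR.
  by rewrite nmulr_rlt0 ?subr_lt0// ln_gt0// ltr1n.
apply: le_lt_trans (nneseries_geometric_lty (mulr_ge0 M0 (powR_ge0 2 q)) r01).
apply: lee_nneseries => [k _ _|k _]; first exact: integral_ge0.
rewrite FE ge0_integralZl//; last by apply/measurable_EFinP; exact: measurable_indic.
have -> : (\int[mu]_x (\1_[set x | (2 ^+ k < `|u x|)%R] x)%:E = (level u (2 ^+ k))%:E)%E.
  by rewrite integral_indic// setIT; apply: levelE => //; rewrite exprn_gt0.
rewrite -EFinM lee_fin.
apply: (le_trans (ler_wpM2l (powR_ge0 _ _) (hM k))).
rewrite mulrCA -mulrA ler_wpM2l// -powR_mulrn ?powR_ge0// -powRrM -!powRD; last 2 first.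
- by apply/implyP.
- by apply/implyP.
by rewrite (_ : _ + _ = q + (q - al) * k%:R)// -natr1; ring.
Qed.

End embedding.

(** * Dilations *)

Section test_functions.
Context {R : realType} {n : nat}.
Local Notation mu := (lebesgue_rV n).
Implicit Types (x v : 'rV[R]_n) (phi : 'rV[R]_n -> R) (c : R).

(** Reduces directional derivatives to one variable, where the chain rule for affine maps is at
    hand. *)
Lemma is_derive_line phi x v d :
  is_derive x v phi d <-> is_derive (0 : R) (1 : R) (fun h : R => phi (h *: v + x)) d.
Proof.
have E : (fun h : R => h^-1 *: ((phi \o shift x) (h *: v) - phi x)) =
    (fun h : R => h^-1 *: (((fun h : R => phi (h *: v + x)) \o shift 0) (h *: (1 : R))
      - (fun h : R => phi (h *: v + x)) 0)).
  apply/funext => h; rewrite /= scale0r add0r addr0.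
  by rewrite /GRing.scale/= mulr1.
by split=> -[dp <-]; apply: DeriveDef; move: dp; rewrite /derivable /derive ?E -?E.
Qed.

Lemma is_derive_dilate phi x v c d : is_derive (c *: x) v phi d ->
  is_derive x v (fun y => phi (c *: y)) (c * d).
Proof.
move=> /is_derive_line dphi; apply/is_derive_line.
have := @is_derive1_comp_affine R c 0 0 (fun h => phi (h *: v + c *: x)) d.
rewrite mulr0 addr0 => /(_ dphi).
rewrite (_ : (fun y => phi ((c * y + 0) *: v + c *: x)) = (fun h => phi (c *: (h *: v + x))))//.
by apply/funext => h; rewrite addr0 scalerDr scalerA.
Qed.

Lemma continuous_dilate phi c : continuous phi -> continuous (fun x => phi (c *: x)).
Proof.
move=> cphi x; apply: (continuous_comp (f := fun x => c *: x)); last exact: cphi.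
exact: scaler_continuous.
Qed.

Lemma partial_dilate phi c i : (forall x, derivable phi x (delta_mx ord0 i)) ->
  partial i (fun x => phi (c *: x)) = (fun x => c * partial i phi (c *: x)).
Proof.
move=> dphi; apply/funext => x; rewrite /partial.
by have [] := is_derive_dilate (derivableP (dphi (c *: x))).
Qed.

(** The prefactor [d] makes the induction work: each differentiation brings out a factor [c]. *)
Lemma Ck_scale_dilate k phi (d c : R) : Ck k phi -> Ck k (fun x => d * phi (c *: x)).
Proof.
elim: k phi d => [|k IH] phi d /= [cphi sphi]; split.
- by move=> x; apply: continuousM; [exact: cst_continuous|exact: (@continuous_dilate phi c cphi x)].
- by [].
- by move=> x; apply: continuousM; [exact: cst_continuous|exact: (@continuous_dilate phi c cphi x)].
move=> i; have [dphi Cphi] := sphi i.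
have D x := is_derive_dilate (derivableP (dphi (c *: x))).
have DZ x : is_derive x (delta_mx ord0 i) (fun x => d * phi (c *: x))
    (d * (c * partial i phi (c *: x))).
  exact: (is_deriveZ d (D x)).
split=> [x|]; first by have [] := DZ x.
rewrite (_ : partial i _ = (fun x => (d * c) * partial i phi (c *: x))); first exact: IH.
by apply/funext => x; rewrite /partial; have [_ ->] := DZ x; rewrite mulrA.
Qed.

Lemma test_function_dilate phi c : c != 0 -> test_function phi ->
  test_function (fun x => phi (c *: x)).
Proof.
move=> c0 [Cphi cK]; split.
  move=> k; rewrite (_ : (fun x => _) = (fun x => 1 * phi (c *: x))); last first.
    by apply/funext => x; rewrite mul1r.
  exact: Ck_scale_dilate.
set K := closure _ in cK.
have cK' : compact [set c^-1 *: x | x in K].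
  by apply: continuous_compact => //; apply: continuous_subspaceT => x; exact: scaler_continuous.
apply: (subclosed_compact _ cK'); first exact: closed_closure.
rewrite [X in _ `<=` X](closure_id _).1; last by apply: compact_closed => //; exact: norm_hausdorff.
apply: closure_subset => x /= phix; exists (c *: x); first exact: subset_closure.
by rewrite scalerA mulVf// scale1r.
Qed.

(** The weak gradient of a dilated function must be checked against every test function, not only
    products, and this supplies the integrability there. *)
Lemma Lfun2_compact_support phi (K : set 'rV[R]_n) : continuous phi -> compact K ->
  (forall x, ~ K x -> phi x = 0) -> phi \in Lfun mu 2%:E.
Proof.
move=> cphi cK phi0.
have clK : closed K by apply: compact_closed => //; exact: norm_hausdorff.
have mK : measurable K.
  by rewrite -(setCK K); apply: measurableC; apply: measurable_open_rV; exact: closed_openC.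
have [M [Mr hM]] := compact_bounded cK.
pose m := (Num.truncn (M + 1)).+1.
have KC : K `<=` cube m.
  move=> x Kx i; rewrite /= in_itv/= !mxE -ltr_norml.
  apply: le_lt_trans (truncnS_gt (M + 1)).
  apply: le_trans (hM (M + 1) _ x Kx); last by rewrite ltrDl.
  rewrite [leRHS]mx_normrE.
  exact: (le_bigmax _ (fun ij : 'I_1 * 'I_n => `|x ij.1 ij.2|) (ord0, i)).
have Koo : (mu K < +oo)%E.
  apply: le_lt_trans (obox_lty (const_mx (- m%:R)) (const_mx m%:R)).
  by apply: le_measure; rewrite ?inE//; exact: measurable_obox.
have cphiK : compact [set phi x | x in K].
  by apply: continuous_compact => //; exact: continuous_subspaceT.
have [N [Nr hN]] := compact_bounded cphiK.
apply: (Lfun2_bounded (M := `|N| + 1) mK Koo) => //; first exact: continuous_measurable_rV.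
move=> x; have [Kx|/phi0 ->] := pselect (K x); last by rewrite normr0 addr_ge0.
apply: hN; last by exists x.
by rewrite (le_lt_trans (ler_norm N))// ltrDl.
Qed.

Lemma Lfun2_test phi : test_function phi -> phi \in Lfun mu 2%:E.
Proof.
move=> [Cphi cK]; apply: (Lfun2_compact_support (K := closure [set x | phi x != 0])) => //.
  by have [] := Cphi 0%N.
move=> x nx; apply/eqP; apply: contra_notT nx => phix; exact: subset_closure.
Qed.

Lemma Lfun2_partial_test phi i : test_function phi -> partial i phi \in Lfun mu 2%:E.
Proof.
move=> [Cphi cK]; apply: (Lfun2_compact_support (K := closure [set x | phi x != 0])) => //.
  by have [_ /(_ i)[_ []]] := Cphi 1%N.
move=> x nx; rewrite /partial (near_eq_derive (g := fun=> 0)); first exact: derive_cst.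
have : nbhs x (~` closure [set x | phi x != 0]).
  by apply: open_nbhs_nbhs; split => //; apply: closed_openC; exact: closed_closure.
apply: filterS => y ny; apply/eqP; apply: contra_notT ny => phiy; exact: subset_closure.
Qed.

End test_functions.

Section dilations.
Context {R : realType} {n : nat}.
Local Notation mu := (lebesgue_rV n).
Implicit Types (x v : 'rV[R]_n) (u w : 'rV[R]_n -> R) (g : 'rV[R]_n -> 'rV[R]_n) (c l q : R).

Lemma ge0_integral_dilate l (f : 'rV[R]_n -> \bar R) : 0 < l ->
  measurable_fun setT f -> (forall x, 0 <= f x)%E ->
  (\int[mu]_x f (l *: x)%R = (l ^- n)%:E * \int[mu]_x f x)%E.
Proof.
move=> l0 mf f0; rewrite -(ge0_integral_affine 0 l0 mf f0).
by apply: eq_integral => x _; rewrite addr0.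
Qed.

Lemma integral_dilate l u : 0 < l -> mu.-integrable setT (EFin \o u) ->
  (\int[mu]_x (u (l *: x)%R)%:E = (l ^- n)%:E * \int[mu]_x (u x)%:E)%E.
Proof.
move=> l0 iu; rewrite -(integral_affine 0 l0 iu).
by apply: eq_integral => x _; rewrite addr0.
Qed.

Lemma measurable_dilate l u : measurable_fun setT u -> measurable_fun setT (fun x => u (l *: x)).
Proof.
move=> mu_; rewrite (_ : (fun x => _) = u \o affine l 0).
  exact: (measurableT_comp mu_ (measurable_affine l 0)).
by apply/funext => x; rewrite /= /affine addr0.
Qed.

Lemma sqint_scale_dilate c l u : 0 < l -> measurable_fun setT u ->
  sqint mu (fun x => c * u (l *: x)) = ((c ^+ 2 * l ^- n)%:E * sqint mu u)%E.
Proof.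
move=> l0 mu_; have m2 : measurable_fun setT (fun x => (u x ^+ 2)%:E).
  by apply/measurable_EFinP; exact: measurable_funX.
rewrite EFinM -muleA /sqint -ge0_integral_dilate//; last by move=> x; rewrite lee_fin sqr_ge0.
rewrite -ge0_integralZl//; last 3 first.
- apply/measurable_EFinP; apply: (@measurable_dilate l (fun x => u x ^+ 2)).
  exact: measurable_funX.
- by move=> x _; rewrite lee_fin sqr_ge0.
- by rewrite lee_fin sqr_ge0.
by apply: eq_integral => x _; rewrite -EFinM exprMn.
Qed.

Lemma Lfun2_scale_dilate c l u : 0 < l -> u \in Lfun mu 2%:E ->
  (fun x => c * u (l *: x)) \in Lfun mu 2%:E.
Proof.
move=> l0 /Lfun2P[mu_ uoo]; apply/Lfun2P; split.
  by apply: measurable_funM => //; exact: measurable_dilate.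
rewrite sqint_scale_dilate// lte_mul_pinfty// lee_fin.
by rewrite mulr_ge0 ?sqr_ge0// invr_ge0 exprn_ge0// ltW.
Qed.

Lemma L2_weak_grad_dilate c l u g : 0 < l -> u \in Lfun mu 2%:E -> L2_weak_grad u g ->
  L2_weak_grad (fun x => c * u (l *: x)) (fun x => (c * l) *: g (l *: x)).
Proof.
move=> l0 uL [gL ug]; split=> [i|i phi tphi].
  rewrite (_ : (fun x => _) = (fun x => c * l * (fun y => g y ord0 i) (l *: x))).
    exact: Lfun2_scale_dilate (gL i).
  by apply/funext => x; rewrite !mxE.
have lN0 : l != 0 by rewrite gt_eqF.
(* The test function is dilated the opposite way, so that both integrands become functions of
   [l *: x]. *)
pose psi x := phi (l^-1 *: x).
have tpsi : test_function psi by apply: test_function_dilate => //; rewrite invr_neq0.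
have phiE x : phi x = psi (l *: x) by rewrite /psi scalerA mulVf// scale1r.
have dphiE x : partial i phi x = l * partial i psi (l *: x).
  rewrite /psi partial_dilate; last by move=> y; have [_ /(_ i)[]] := tphi.1 1%N.
  by rewrite mulrA mulfV// mul1r scalerA mulVf// scale1r.
have i1 := Lfun2_integrableM uL (Lfun2_partial_test i tpsi).
have i2 := Lfun2_integrableM (gL i) (Lfun2_test tpsi).
transitivity (\int[mu]_x ((c * l)%:E * (u (l *: x)%R * partial i psi (l *: x)%R)%:E))%E.
  by apply: eq_integral => x _; rewrite dphiE -EFinM; congr EFin; ring.
rewrite integralZl//; last first.
  have := integrable_affine 0 l0 i1; apply: eq_integrable => // x _.
  by rewrite addr0.
rewrite (integral_dilate l0 i1) ug//.
transitivity (- \int[mu]_x ((c * l)%:E * (g (l *: x)%R ord0 i * psi (l *: x)%R)%:E))%E; last first.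
  congr (- _)%E; apply: eq_integral => x _; rewrite phiE -EFinM mxE; congr EFin; ring.
rewrite integralZl//; last first.
  have := integrable_affine 0 l0 i2; apply: eq_integrable => // x _.
  by rewrite addr0.
by rewrite (integral_dilate l0 i2) !muleN.
Qed.

Lemma sqgrad_scale_dilate c l g : 0 < l -> (forall i, (fun x => g x ord0 i) \in Lfun mu 2%:E) ->
  sqgrad (fun x => (c * l) *: g (l *: x)) = (((c * l) ^+ 2 * l ^- n)%:E * sqgrad g)%E.
Proof.
move=> l0 gL; rewrite /sqgrad ge0_sume_distrr; last by move=> i _; exact: sqint_ge0.
apply: eq_bigr => i _; rewrite -(sqint_scale_dilate _ l0 (Lfun2_measurable (gL i))).
by congr (sqint mu _); apply/funext => x; rewrite !mxE.
Qed.

Lemma weak_gradP u : sobolev_H1 u -> L2_weak_grad u (weak_grad u).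
Proof. by move=> [_ [g ug]]; exact: (getPex (ex_intro _ g ug)). Qed.

(** Makes the kinetic term independent of the choice in [weak_grad], by a.e. uniqueness in each
    coordinate. *)
Lemma sqgrad_weak_grad u g : L2_weak_grad u g -> sobolev_H1 u ->
  ('N[mu]_2%:E[EFin \o (eucl_norm \o weak_grad u)] ^+ 2 = sqgrad g)%E.
Proof.
move=> ug /weak_gradP uw; rewrite sqr_Lnorm2.
rewrite /sqint /sqgrad -ge0_integral_sum//; last 2 first.
- by move=> i; apply/measurable_EFinP; apply: measurable_funX; exact: (Lfun2_measurable (ug.1 i)).
- by move=> i x _; rewrite lee_fin sqr_ge0.
rewrite [LHS](_ : _ = \int[mu]_x (\sum_i ((weak_grad u x ord0 i) ^+ 2)%:E))%E; last first.
  apply: eq_integral => x _; rewrite /= sqr_sqrtr ?sumEFin//.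
  by apply: sumr_ge0 => i _; exact: sqr_ge0.
apply: ae_eq_integral => //.
- apply: emeasurable_sum => i; apply/measurable_EFinP; apply: measurable_funX.
  exact: (Lfun2_measurable (uw.1 i)).
- apply: emeasurable_sum => i; apply/measurable_EFinP; apply: measurable_funX.
  exact: (Lfun2_measurable (ug.1 i)).
have := filter_forall (ae_filter_ringOfSetsType mu) (fun i => weak_grad_unique i uw ug).
by apply: filterS => x gx _; apply: eq_bigr => i _; rewrite gx.
Qed.

Lemma integral_powR_scale_dilate c l q u : 0 <= c -> 0 < l -> measurable_fun setT u ->
  (\int[mu]_x (`|c * u (l *: x)%R| `^ q)%:E =
   (c `^ q * l ^- n)%:E * \int[mu]_x (`|u x| `^ q)%:E)%E.
Proof.
move=> c0 l0 mu_.
have mq : measurable_fun setT (fun x => (`|u x| `^ q)%:E).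
  apply/measurable_EFinP; apply: (measurableT_comp (measurable_powR q)).
  exact: measurableT_comp.
rewrite EFinM -muleA -ge0_integral_dilate//.
rewrite -ge0_integralZl//; last 2 first.
- apply/measurable_EFinP; apply: (@measurable_dilate l (fun x => `|u x| `^ q)).
  exact/measurable_EFinP.
- by rewrite lee_fin powR_ge0.
by apply: eq_integral => x _; rewrite -EFinM normrM (ger0_norm c0) powRM.
Qed.

End dilations.

(** * Scaling of mass and energy *)

Section mass_preserving_dilation.
Context {R : realType} {n : nat}.
Local Notation mu := (lebesgue_rV n).
Implicit Types (u : 'rV[R]_n -> R) (g : 'rV[R]_n -> 'rV[R]_n) (l p : R).

Definition mass_dilate l u : 'rV[R]_n -> R := fun x => l `^ (n%:R / 2) * u (l *: x).

Lemma sqr_mass_factor l : 0 < l -> (l `^ (n%:R / 2)) ^+ 2 = l ^+ n.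
Proof.
move=> l0; rewrite -powR_mulrn ?powR_ge0// -powRrM divfK ?pnatr_eq0//.
by rewrite powR_mulrn// ltW.
Qed.

Lemma sobolev_H1_mass_dilate l u : 0 < l -> sobolev_H1 u -> sobolev_H1 (mass_dilate l u).
Proof.
move=> l0 [uL [g ug]]; split; first exact: Lfun2_scale_dilate.
by eexists; exact: L2_weak_grad_dilate l0 uL ug.
Qed.

Lemma mass_mass_dilate l u : 0 < l -> u \in Lfun mu 2%:E -> mass (mass_dilate l u) = mass u.
Proof.
move=> l0 uL; rewrite /mass !sqr_Lnorm2 sqint_scale_dilate//; last exact: Lfun2_measurable.
by rewrite sqr_mass_factor// mulfV ?mul1e// gt_eqF// exprn_gt0.
Qed.

(** The powers of [l] are (n / 2 + 1) * 2 - n = 2 for the gradient and (n / 2)(p + 1) - n = n (p -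
    1) / 2 for the potential, whose integral may still be infinite here. *)
Lemma energy_mass_dilate p l u : 0 < l -> sobolev_H1 u ->
  energy p (mass_dilate l u) =
  (2^-1%:E * ((l ^+ 2)%:E * sqgrad (weak_grad u)) -
   (p + 1)^-1%:E * ((l `^ (n%:R * (p - 1) / 2))%:E * \int[mu]_x (`|u x| `^ (p + 1))%:E))%E.
Proof.
move=> l0 uH; have uw := weak_gradP uH; have [uL _] := uH.
have ln0 : l ^+ n != 0 by rewrite gt_eqF// exprn_gt0.
have wl := L2_weak_grad_dilate (l `^ (n%:R / 2)) l0 uL uw.
rewrite /energy (sqgrad_weak_grad wl (sobolev_H1_mass_dilate l0 uH)).
rewrite sqgrad_scale_dilate//; last exact: uw.1.
rewrite exprMn sqr_mass_factor// mulrAC mulfV// mul1r.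
rewrite integral_powR_scale_dilate ?powR_ge0//; last exact: Lfun2_measurable.
congr (_ - _ * (_%:E * _))%E.
rewrite -powRrM -powR_mulrn ?ltW// -powRN -powRD; last by rewrite (gt_eqF l0) implybT.
by congr (_ `^ _); field.
Qed.

(** Otherwise [u] would vanish a.e., against its positive square integral; this is what makes the
    potential energy strictly positive. *)
Lemma integral_powR_gt0 q u : measurable_fun setT u -> (0 < sqint mu u)%E ->
  (0 < \int[mu]_x (`|u x| `^ q)%:E)%E.
Proof.
move=> mu_ su; rewrite lt_neqAle eq_sym integral_ge0 ?andbT; last first.
  by move=> x _; rewrite lee_fin powR_ge0.
apply: contraTneq su => I0; rewrite -leNgt le_eqVlt; apply/orP; left; apply/eqP.
have mq : measurable_fun setT (fun x => (`|u x| `^ q)%:E).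
  apply/measurable_EFinP; apply: (measurableT_comp (measurable_powR q)).
  exact: measurableT_comp.
have /(ae_eq_integral_abs mu measurableT mq) uq0 :
    (\int[mu]_x `|(`|u x| `^ q)%:E| = 0)%E.
  by rewrite -I0; apply: eq_integral => x _; rewrite gee0_abs// lee_fin powR_ge0.
rewrite /sqint -(integral0 mu setT); apply: ae_eq_integral => //.
  by apply/measurable_EFinP; exact: measurable_funX.
move: uq0; apply: filterS => x /[apply] -[] /powR_eq0_eq0.
by move=> /eqP; rewrite normr_eq0 => /eqP ->; rewrite expr0n.
Qed.

End mass_preserving_dilation.

(** Choose [l] with l^(s - 2) = r. Since r b = a + b + 1, the left side equals -l^2 (b + 1), and
    [l >= 1] makes it at most -(b + 1) < a - b. *)
Lemma supercritical_scaling_unbounded (R : realType) (a b s : R) :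
  0 <= a -> 0 < b -> 2 < s ->
  exists2 l, 0 < l & l ^+ 2 * a - l `^ s * b < a - b.
Proof.
move=> a0 b0 s2; pose r := (a + b + 1) / b.
have r1 : 1 <= r by rewrite ler_pdivlMr// mul1r; lra.
pose l := r `^ (s - 2)^-1.
have s20 : s - 2 != 0 by rewrite subr_eq0 gt_eqF.
have l0 : 0 < l by rewrite powR_gt0// (lt_le_trans _ r1).
have l1 : 1 <= l.
  by rewrite -[leLHS](powRr0 r) ler_powR// invr_ge0 subr_ge0 ltW.
have ls : l `^ s = l ^+ 2 * r.
  rewrite -[in LHS](subrK 2 s) addrC powRD; last by rewrite (gt_eqF l0) implybT.
  by rewrite powR_mulrn ?ltW// -powRrM mulVf// powRr1// (le_trans _ r1).
exists l => //; rewrite ls -mulrA divfK ?gt_eqF// -mulrBr.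
have : 1 <= l ^+ 2 by rewrite exprn_ege1.
set m := l ^+ 2; nra.
Qed.

Theorem propositionA2p5 (R : realType) (n : nat) (p : R)
  (n_ge2 : (2 <= n)%N)
  (p_gt : 1 + 4 / n%:R < p)
  (p_lt : (2 < n)%N -> p < (n%:R + 2) / (n%:R - 2)) :
  forall beta : R, 0 < beta ->
  ~ exists u : 'rV[R]_n -> R,
      [/\ sobolev_H1 u,
          mass u = beta%:E &
          energy p u =
          ereal_inf [set energy p w | w in
            [set w : 'rV[R]_n -> R | sobolev_H1 w /\ mass w = beta%:E]]].
Proof.
move=> beta beta0 [u [uH umass umin]].
have [uL _] := uH; have uw := weak_gradP uH.
have n0 : 0 < n%:R :> R by rewrite ltr0n (leq_trans _ n_ge2).
have p1 : 1 < p by apply: le_lt_trans p_gt; rewrite lerDl divr_ge0// ltW.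
(* For n = 2 the coefficient is 0; for n >= 3 the upper bound on [p] says p + 1 < 2n / (n - 2). *)
have qn : (1 - 2 / n%:R) * (p + 1) < 2.
  move: n_ge2; rewrite leq_eqVlt => /predU1P[<-|n3].
    by rewrite divff// subrr mul0r.
  have n2 : 0 < n%:R - 2 :> R by rewrite subr_gt0 ltr_nat.
  have := p_lt n3; rewrite ltr_pdivlMr// => pn.
  rewrite (_ : 1 - 2 / n%:R = (n%:R - 2) / n%:R); last by field; rewrite gt_eqF.
  rewrite mulrAC ltr_pdivrMr//; lra.
have Boo := subcritical_embedding n_ge2 uH (_ : 2 <= p + 1) qn.
have {}Boo : (\int[lebesgue_rV n]_x (`|u x| `^ (p + 1))%:E < +oo)%E by apply: Boo; lra.
have su : (0 < sqint (lebesgue_rV n) u)%E by rewrite -sqr_Lnorm2 -/(mass u) umass lte_fin.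
have B0 := integral_powR_gt0 (p + 1) (Lfun2_measurable uL) su.
have Afin := sqgrad_fin uw.1.
have A0 : (0 <= sqgrad (weak_grad u))%E.
  by apply: sume_ge0 => i _; exact: sqint_ge0.
have Emin l : 0 < l -> (energy p u <= energy p (mass_dilate l u))%E.
  move=> l0; rewrite umin; apply: ereal_inf_lbound; exists (mass_dilate l u) => //.
  by split; [exact: sobolev_H1_mass_dilate|rewrite mass_mass_dilate].
have E1 := energy_mass_dilate p ltr01 uH.
(* At [l = 1] the scaling formula gives the energy of [u] in the same shape as that of its
   competitors. *)
have u1 : mass_dilate 1 u = u by apply/funext => x; rewrite /mass_dilate powR1 mul1r scale1r.
rewrite u1 in E1.
have s2 : 2 < n%:R * (p - 1) / 2.
  have : 4 / n%:R < p - 1 by rewrite ltrBrDl.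
  rewrite ltr_pdivrMr// ltr_pdivlMr// => h; lra.
set B := (\int[_]_x _)%E in Boo B0 E1.
(* Finiteness of [B] brings the comparison of energies down to real numbers. *)
have Bfin : B \is a fin_num by rewrite ge0_fin_numE// ltW.
have := @supercritical_scaling_unbounded R (2^-1 * fine (sqgrad (weak_grad u)))
  ((p + 1)^-1 * fine B) (n%:R * (p - 1) / 2).
case.
- by rewrite mulr_ge0// fine_ge0.
- by rewrite mulr_gt0 ?invr_gt0 ?fine_gt0 ?B0//; lra.
- exact: s2.
move=> l l0; have := Emin l l0; rewrite E1 energy_mass_dilate// -/B.
rewrite -(fineK Afin) -(fineK Bfin) -!EFinM -!EFinB lee_fin powR1 expr1n !mul1r.
rewrite leNgt => /negP H; move=> K; apply: H; move: K.
by rewrite (mulrCA _ 2^-1) (mulrCA _ (p + 1)^-1).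
Qed.
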